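(* Let $\boldsymbol\theta$ be a torsion-free directive sequence defined on a sequence of alphabets of bounded size. Suppose that $(X_{\boldsymbol\theta},\sigma)$ is uniquely ergodic with unique $\sigma$-invariant probability measure $\mu$, and that the column number satisfies $c(\boldsymbol\theta)>1$. Then either $(X_{\boldsymbol\theta},\sigma,\mu)$ has mixed spectrum, or $(X_{\boldsymbol\theta},\sigma,\mu)$ has discrete spectrum but admits discontinuous eigenfunctions (i.e. some measurable eigenvalue has no continuous eigenfunction).
   Context: Alphabets are finite sets. A morphism $\theta:\mathcal A\to\mathcal B^+$ maps letters to non-empty words and is extended by concatenation to words and to $\mathcal A^{\mathbb Z}$ (with $\theta(x_0)$ starting at index $0$). $\sigma$ is the left shift. A directive sequence is a sequence $\boldsymbol\theta=(\theta^{(n)})_{n\ge 0}$ of morphisms $\theta^{(n)}:\mathcal A_{n+1}\to\mathcal A_n^+$; bounded size means $\sup_n|\mathcal A_n|<\infty$. Put $\theta^{[n,N)}=\theta^{(n)}\circ\cdots\circ\theta^{(N-1)}$. $X^{(n)}_{\boldsymbol\theta}=X^{(n)}$ is the set of $x\in\mathcal A_n^{\mathbb Z}$ all of whose finite subwords are subwords of $\theta^{[n,N)}(a)$ for some $N>n$ and $a\in\mathcal A_N$; $X_{\boldsymbol\theta}=X^{(0)}_{\boldsymbol\theta}$. $\boldsymbol\theta$ is constant-length with length sequence $(q_n)$ if $|\theta^{(n)}(a)|=q_n$ for all $n$ and all $a\in\mathcal A_{n+1}$; $p_0=1$, $p_n=q_0\cdots q_{n-1}$. $\boldsymbol\theta$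 is injective if each $\theta^{(n)}$ is injective on letters. $\boldsymbol\theta$ is torsion-free if it is constant-length with length sequence $(q_n)$, $q_n>1$ for infinitely many $n$, each $(X^{(n)}_{\boldsymbol\theta},\sigma)$ is minimal, $X^{(0)}_{\boldsymbol\theta}$ is aperiodic (contains no $\sigma$-periodic point), and every prime dividing some $q_k$ divides $q_n$ for infinitely many $n$. Height: with $\mathbb Z_{(q_n)}=\varprojlim\mathbb Z/p_n\mathbb Z$, a torsion-free $\boldsymbol\theta$ on alphabets of bounded size has maximal equicontinuous factor the rotation by $(1,1)$ on $\mathbb Z_{(q_n)}\times\mathbb Z/h\mathbb Z$ for some $h$ coprime to every $q_n$; $h$ is the height of $\boldsymbol\theta$. Pure base: with $h$ the height, fix $(u^{(n)})_{n\ge0}$ with $u^{(n)}\in X^{(n)}$ and $\theta^{(n)}(u^{(n+1)})=u^{(n)}$ for all $n$. Let $\mathcal W^{(n)}$ be the set of words of length $h$ appearing in $u^{(n)}$ at an index in $\{kh:k\ge0\}$, $\mathcal B^{(n)}$ an alphabet with a bijection $\bar\tau_n:\mathcal B^{(n)}\to\mathcal W^{(n)}$, $\tau_n=\bar\tau_n^{-1}$, both extended to concatenations. The pure base is $\bar{\boldsymbol\theta}=(\bar\theta^{(n)})_{n\ge0}$ with $\bar\theta^{(n)}:\mathcal B^{(n+1)}\to(\mathcal B^{(n)})^{q_n}$, $\bar\theta^{(n)}(b)=\tau_n(\theta^{(n)}(\bar\tau_{n+1}(b)))$. Injectivisation $\widehat{\boldsymbol\theta}$ of a constant-length directive sequence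 $\boldsymbol\theta$: let $\mathcal B_0=\mathcal A_0$, $\kappa_0=\mathrm{id}$. Recursively, put $\eta^{(n)}=\kappa_n\circ\theta^{(n)}:\mathcal A_{n+1}\to\mathcal B_n^{q_n}$ ($\kappa_n$ applied letterwise), let $\kappa_{n+1}:\mathcal A_{n+1}\to\mathcal B_{n+1}$ be the quotient map identifying $a,a'$ exactly when $\eta^{(n)}(a)=\eta^{(n)}(a')$, and let $\widehat\theta^{(n)}(b)=\eta^{(n)}(a)$ for any $a\in\kappa_{n+1}^{-1}(b)$; $\widehat{\boldsymbol\theta}=(\widehat\theta^{(n)})_{n\ge0}$. Column numbers: for a morphism of constant length $\ell$ write $\theta(a)=\theta_0(a)\cdots\theta_{\ell-1}(a)$. For injective $\boldsymbol\theta$ let $c(\boldsymbol\theta,m)=\inf_{n>m}\{|(\theta^{[m,n)})_j(\mathcal A_n)|:0\le j<p_n/p_m\}$ (non-decreasing in $m$) and $\bar c(\boldsymbol\theta)=\max_m c(\boldsymbol\theta,m)$; for non-injective $\boldsymbol\theta$, $\bar c(\boldsymbol\theta):=\bar c(\widehat{\boldsymbol\theta})$ (naïve column number). The column number is $c(\boldsymbol\theta):=\bar c(\bar{\boldsymbol\theta})$. Spectrum: a measurable eigenfunction is a nonzero $f\in L^2(X,\mu)$ with $f\circ\sigma=\lambda f$ for some $\lambda\in S^1$ (the measurable eigenvalue). Let $H_d$ be the closed span of all measurable eigenfunctions. $(X,\sigma,\mu)$ has discrete spectrum if $H_d=L^2(X,\mu)$, and mixed spectrum otherwise. *)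

(* Defs.v *)
From HB Require Import structures.
From mathcomp Require Import all_boot all_order all_algebra.
From mathcomp Require Import all_classical all_reals all_analysis.
From mathcomp Require Export complex.

Set Implicit Arguments.
Unset Strict Implicit.
Unset Printing Implicit Defensive.

Import Order.TTheory GRing.Theory Num.Theory.
Import numFieldNormedType.Exports.

Local Open Scope classical_set_scope.
Local Open Scope ring_scope.

Definition extend {A B : Type} (f : A -> seq B) (w : seq A) : seq B :=
  flatten (map f w).

Record directive := Directive {
  alph : nat -> finType;
  alph_gt0 : forall n, (0 < #|alph n|)%N;
  morph : forall n, alph n.+1 -> seq (alph n);
  morph_neq0 : forall n (a : alph n.+1), morph a != [::] }.

Arguments morph : clear implicits.

Definition bounded_size (th : directive) : Prop :=
  exists M : nat, forall n, (#|alph th n| <= M)%N.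

(* [morph_iter th n k] is theta^[n, k + n). *)
Fixpoint morph_iter (th : directive) (n k : nat) :
    alph th (k + n) -> seq (alph th n) :=
  match k with
  | 0 => fun a => [:: a]
  | k'.+1 => fun a => extend (@morph_iter th n k') (morph th (k' + n) a)
  end.

(* The alphabet is discrete and the full shift carries the product topology. *)
Definition fullshift (th : directive) (n : nat) : Type := int -> alph th n.

Section FullshiftInstances.
Variables (th : directive) (n : nat).

HB.instance Definition _ := Choice.on (fullshift th n).
HB.instance Definition _ := isPointed.Build (fullshift th n)
  (fun _ => enum_val (Ordinal (alph_gt0 th n))).
HB.instance Definition _ := Topological.copy (fullshift th n)
  (prod_topology (fun _ : int => discrete_topology (alph th n))).

End FullshiftInstances.

Section Shift.
Variables (th : directive) (n : nat).

Definition shift_map (x : fullshift th n) : fullshift th n := fun i => x (i + 1).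

Definition word (x : fullshift th n) (i : int) (l : nat) : seq (alph th n) :=
  mkseq (fun j => x (i + j%:Z)) l.

Definition subshift : set (fullshift th n) :=
  [set x | forall (i : int) (l : nat), exists k (a : alph th (k + n)),
     (0 < k)%N /\ infix (word x i l) (morph_iter a)].

End Shift.

Arguments subshift : clear implicits.

(* [y = theta^(n)(x)]: the words theta(x_0 ... x_(k-1)) and
   theta(x_(-k) ... x_(-1)) lie immediately right and left of the origin. *)
Definition morph_image (th : directive) (n : nat)
    (x : fullshift th n.+1) (y : fullshift th n) : Prop :=
  forall k : nat,
    let wr := extend (morph th n) (word x 0 k) in
    let wl := extend (morph th n) (word x (- k%:Z) k) in
    word y 0 (size wr) = wr /\ word y (- (size wl)%:Z) (size wl) = wl.

Definition minimal_system {T : topologicalType} (X : set T) (S : T -> T) : Prop :=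
  X !=set0 /\
  forall Y : set T, closed Y -> Y !=set0 -> Y `<=` X -> S @` Y `<=` Y -> Y = X.

Definition aperiodic {T : Type} (X : set T) (S : T -> T) : Prop :=
  forall x n, X x -> (0 < n)%N -> iter n S x <> x.

Definition constant_length (th : directive) (q : nat -> nat) : Prop :=
  forall n (a : alph th n.+1), size (morph th n a) = q n.

(* [q] is explicit, because later notions refer to the length sequence. *)
Definition torsion_free (th : directive) (q : nat -> nat) : Prop :=
  [/\ constant_length th q,
      forall N, exists2 n, (N <= n)%N & (1 < q n)%N,
      forall n, minimal_system (subshift th n) (@shift_map th n),
      aperiodic (subshift th 0) (@shift_map th 0)
    & forall p k, prime p -> (p %| q k)%N ->
        forall N, exists2 n, (N <= n)%N & (p %| q n)%N].

(* p_n = q_0 ... q_(n-1) *)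
Definition pp (q : nat -> nat) (n : nat) : nat := (\prod_(i < n) q i)%N.

(* A system is a map [S] restricted to an invariant set [K] of its type. *)
Definition equicontinuous_system {U : puniformType} (K : set U) (S : U -> U) :
    Prop :=
  [/\ hausdorff_space U, compact K, S @` K `<=` K
    & equicontinuous [set: nat] (fun n => (iter n S : subspace K -> U))].

Definition factor_map {T U : topologicalType} (X : set T) (S : T -> T)
    (Y : set U) (S' : U -> U) (f : T -> U) : Prop :=
  [/\ {within X, continuous f}, f @` X = Y
    & forall x, X x -> f (S x) = S' (f x)].

Definition max_equicontinuous_factor {T : topologicalType} {U : puniformType}
    (X : set T) (S : T -> T) (Y : set U) (S' : U -> U) : Prop :=
  equicontinuous_system Y S' /\
  exists2 f : T -> U, factor_map X S Y S' f &
    forall (V : puniformType) (K : set V) (S'' : V -> V) (g : T -> V),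
      equicontinuous_system K S'' -> factor_map X S K S'' g ->
      exists2 phi : U -> V, factor_map Y S' K S'' phi &
        forall x, X x -> g x = phi (f x).

(* Z/mZ for m > 0 as a group: unlike ['Z_m], this is also correct for m = 1. *)
Notation Zmod m := 'I_m.-1.+1.

(* The compact group (prod_n Z/p_n) * Z/h, which contains Z_(q_n) * Z/h. *)
Definition odometer_space (q : nat -> nat) (h : nat) : Type :=
  (prod_topology (fun n : nat => discrete_topology (Zmod (pp q n))) *
   discrete_topology (Zmod h))%type.

Section OdometerInstances.
Variables (q : nat -> nat) (h : nat).

HB.instance Definition _ := Uniform.copy (odometer_space q h)
  (prod_topology (fun n : nat => discrete_topology (Zmod (pp q n))) *
   discrete_topology (Zmod h))%type.
HB.instance Definition _ := isPointed.Build (odometer_space q h)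
  ((fun n => 0 : Zmod (pp q n)), (0 : Zmod h)).

End OdometerInstances.

Definition odometer (q : nat -> nat) (h : nat) : set (odometer_space q h) :=
  [set z | forall n, (z.1 n.+1 : Zmod _) = (z.1 n : Zmod _) %[mod pp q n]].

Definition rotation (q : nat -> nat) (h : nat) (z : odometer_space q h) :
    odometer_space q h :=
  ((fun n => (z.1 n : Zmod (pp q n)) + inZp 1), (z.2 : Zmod h) + inZp 1).

Definition is_height (th : directive) (q : nat -> nat) (h : nat) : Prop :=
  [/\ (0 < h)%N, forall n, coprime h (q n)
    & max_equicontinuous_factor (subshift th 0) (@shift_map th 0)
        (@odometer q h) (@rotation q h)].

(* The letters of the pure base are identified with words through [tau]. *)
Definition is_pure_base (th : directive) (h : nat)
    (u : forall n, fullshift th n) (bth : directive) : Prop :=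
  exists tau : forall n, alph bth n -> seq (alph th n),
    [/\ forall n, injective (tau n),
        forall n, range (tau n) = [set word (u n) (k * h)%N%:Z h | k in setT]
      & forall n (b : alph bth n.+1),
          extend (tau n) (morph bth n b) = extend (morph th n) (tau n.+1 b)].

Section Injectivisation.
Variable th : directive.

(* The pair (B_n, kappa_n). The quotient B_(n+1) of A_(n+1) by the equality of
   eta^(n) is realised as the set of values of eta^(n), so that kappa_(n+1) is
   eta^(n) and the induced map on B_(n+1) is the inclusion. *)
Fixpoint inj_quotient (n : nat) : {B : finType & alph th n -> B} :=
  match n with
  | 0 => existT (fun B : finType => alph th 0 -> B) (alph th 0) id
  | m.+1 =>
      let eta (a : alph th m.+1) :=
        map (projT2 (inj_quotient m)) (morph th m a) in
      existT (fun B : finType => alph th m.+1 -> B)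
        (seq_sub (codom eta) : finType) (fun a => SeqSub (codom_f eta a))
  end.

Definition inj_alph (n : nat) : finType := projT1 (inj_quotient n).

Lemma inj_alph_gt0 n : (0 < #|inj_alph n|)%N.
Proof.
have /card_gt0P [a _] := alph_gt0 th n.
by apply/card_gt0P; exists (projT2 (inj_quotient n) a).
Qed.

Definition inj_morph (n : nat) (b : inj_alph n.+1) : seq (inj_alph n) := val b.

Lemma inj_morph_neq0 n (b : inj_alph n.+1) : inj_morph b != [::].
Proof.
have /codomP [a] := ssvalP b; rewrite /inj_morph /= => ->.
by rewrite -size_eq0 size_map size_eq0 morph_neq0.
Qed.

Definition injectivisation : directive := Directive inj_alph_gt0 inj_morph_neq0.

End Injectivisation.

Definition injective_directive (th : directive) : Prop :=
  forall n, injective (morph th n).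

Definition column (th : directive) (m k j : nat) : {set option (alph th m)} :=
  [set onth (morph_iter a) j | a : alph th (k + m)].

(* The set below is non-empty, so the infimum is its minimum; the numbers are
   bounded by the alphabet sizes, so for bounded alphabets the supremum in
   [column_number_inj] is a maximum. *)
Definition column_number_from (th : directive) (q : nat -> nat) (m : nat) : nat :=
  infimum 0%N [set c | exists k j, [/\ (0 < k)%N,
    (j < pp q (k + m) %/ pp q m)%N & c = #|column th m k j|]].

Definition column_number_inj (th : directive) (q : nat -> nat) : nat :=
  supremum 0%N (range (column_number_from th q)).

Definition naive_column_number (th : directive) (q : nat -> nat) : nat :=
  if `[< injective_directive th >] then column_number_inj th q
  else column_number_inj (injectivisation th) q.

(* [c] is the column number of [th], computed from some choice of the fibre
   [u] and of the alphabets of the pure base. *)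
Definition is_column_number (th : directive) (q : nat -> nat) (c : nat) : Prop :=
  exists h (u : forall n, fullshift th n) (bth : directive),
    [/\ is_height th q h,
        forall n, subshift th n (u n) /\ morph_image (u n.+1) (u n),
        is_pure_base h u bth
      & c = naive_column_number bth q].

Definition borel (T : ptopologicalType) := g_sigma_algebraType (@open T).

HB.instance Definition _ (T : ptopologicalType) := Measurable.on (borel T).

Section Spectrum.
Variables (R : realType) (T : ptopologicalType) (S : T -> T).
Variable mu : probability (borel T) R.

Definition invariant_measure (nu : probability (borel T) R) : Prop :=
  forall A : set (borel T), measurable A -> nu (S @^-1` A) = nu A.

(* Borel measures on the closed set [X] are the Borel measures of the ambient
   space that give full mass to [X]. *)
Definition unique_invariant_measure (X : set T) : Prop :=
  [/\ invariant_measure mu, mu X = 1%E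
    & forall nu : probability (borel T) R,
        invariant_measure nu -> nu X = 1%E ->
        forall A : set (borel T), measurable A -> nu A = mu A].

(* A complex function is given by its real and imaginary parts; as [mu] is
   carried by the subshift, functions on the ambient space modulo [mu]-null sets
   are the same as functions on the subshift. *)
Definition L2norm (f : T -> R[i]) : \bar R :=
  Lnorm mu 2%:E (fun x : borel T => (ComplexField.Normc.normc (f x))%:E).

Definition L2 : set (T -> R[i]) :=
  [set f | [/\ measurable_fun [set: borel T] (fun x => complex.Re (f x)),
               measurable_fun [set: borel T] (fun x => complex.Im (f x))
             & (L2norm f < +oo)%E]].

Definition is_eigenfunction (f : T -> R[i]) (lam : R[i]) : Prop :=
  [/\ L2 f, ~ {ae mu, forall x : borel T, f x = 0}, `|lam| = 1
    & {ae mu, forall x : borel T, f (S x) = lam * f x}].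

Definition is_eigenvalue (lam : R[i]) : Prop :=
  exists f, is_eigenfunction f lam.

Definition eigen_span : set (T -> R[i]) :=
  [set g | exists (N : nat) (c lam : 'I_N -> R[i]) (f : 'I_N -> T -> R[i]),
     (forall i, is_eigenfunction (f i) (lam i)) /\
     forall x, g x = \sum_(i < N) c i * f i x].

Definition eigen_closed_span : set (T -> R[i]) :=
  [set f | L2 f /\ forall e : R, 0 < e ->
     exists2 g, eigen_span g & (L2norm (fun x => f x - g x)%R < e%:E)%E].

Definition discrete_spectrum : Prop := eigen_closed_span = L2.

Definition mixed_spectrum : Prop := ~ discrete_spectrum.

End Spectrum.

Definition has_continuous_eigenfunction (R : realType) (T : topologicalType)
    (X : set T) (S : T -> T) (lam : R[i]) : Prop :=
  exists f : T -> R[i],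
    [/\ {within X, continuous (fun x => complex.Re (f x) : R)},
        {within X, continuous (fun x => complex.Im (f x) : R)},
        exists2 x, X x & f x != 0
      & forall x, X x -> f (S x) = lam * f x].

(* Main.v *)
Require Import Defs.
From HB Require Import structures.
From mathcomp Require Import all_boot all_order all_algebra finmap.
From mathcomp Require Import all_classical all_reals all_analysis.
From mathcomp Require Import measurable_realfun ring lra zify.

(** Suppose that the spectrum is discrete and that every measurable eigenvalue
    has a continuous eigenfunction. Continuous eigenfunctions factor through the
    odometer, so every eigenvalue is a root of unity of order dividing some
    p_n h, and by discreteness and ergodicity the letter at 0 is, up to small
    measure, a function of the phase of the point modulo p_n h. Unique ergodicity
    makes this uniform: in the sequence u, any two long windows whose positions
    agree modulo p_n h have small normalised Hamming distance. This applies to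
    the images under theta^[0, N) of the letters of the N-th alphabet of the pure
    base. If all columns of theta^[m, N) had two letters, then, the alphabets
    being bounded, two such images would differ in a proportion of places bounded
    below independently of N; hence the column number is 1. *)

Set Implicit Arguments.
Unset Strict Implicit.
Unset Printing Implicit Defensive.

Import Order.TTheory GRing.Theory Num.Theory.
Import numFieldNormedType.Exports.
Import ComplexField.Normc.

Local Open Scope classical_set_scope.
Local Open Scope nat_scope.

(** * Hamming distance and column numbers *)

Definition hamming {A : eqType} (s t : seq A) : nat :=
  count (fun p => p.1 != p.2) (zip s t).

Lemma hamming_cat {A : eqType} (s1 s2 t1 t2 : seq A) : size s1 = size t1 ->
  hamming (s1 ++ s2) (t1 ++ t2) = hamming s1 t1 + hamming s2 t2.
Proof. by move=> st; rewrite /hamming zip_cat// count_cat. Qed.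

Lemma hamming_gt0 {A : eqType} (s t : seq A) : size s = size t -> s != t ->
  0 < hamming s t.
Proof.
elim: s t => [|a s IH] [|b t]//= [st]; rewrite /hamming /= eqseq_cons.
by case: (a =P b) => //= _ /(IH _ st).
Qed.

Lemma extend_cons {A B : Type} (f : A -> seq B) a w :
  extend f (a :: w) = f a ++ extend f w.
Proof. by []. Qed.

Lemma extend_cat {A B : Type} (f : A -> seq B) v w :
  extend f (v ++ w) = extend f v ++ extend f w.
Proof. by rewrite /extend map_cat flatten_cat. Qed.

Lemma extend_comp {A B C : Type} (f : A -> seq B) (g : B -> seq C) w :
  extend g (extend f w) = extend (fun a => extend g (f a)) w.
Proof. by elim: w => // a w IH; rewrite !extend_cons extend_cat IH. Qed.

Lemma size_extend {A B : Type} (f : A -> seq B) l w :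
  (forall a, size (f a) = l) -> size (extend f w) = size w * l.
Proof. by move=> fl; elim: w => // a w IH; rewrite extend_cons size_cat fl IH mulSn. Qed.

(** Distinct letters have distinct images of equal length, so every disagreement produces at least
    one in its own block. *)
Lemma hamming_extend {A B : eqType} (f : A -> seq B) l s t :
  injective f -> (forall a, size (f a) = l) -> size s = size t ->
  hamming s t <= hamming (extend f s) (extend f t).
Proof.
move=> fI fl; elim: s t => [|a s IH] [|b t]//= [st].
rewrite !extend_cons hamming_cat ?fl// -cat1s -[b :: t]cat1s hamming_cat//.
apply: leq_add; last exact: IH.
rewrite /hamming /= addn0; case: (a =P b) => //= ab.
by apply: hamming_gt0; rewrite ?fl//; apply/eqP => /fI.
Qed.

Lemma hamming_sum {A : eqType} x0 (s t : seq A) : size s = size t ->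
  hamming s t = \sum_(j < size s) (nth x0 s j != nth x0 t j).
Proof.
elim: s t => [|a s IH] [|b t]//=; first by rewrite big_ord0.
by move=> [st]; rewrite big_ord_recl /= -IH.
Qed.

(* theta^[0, n) as a map on the letters of level [n]; in [morph_iter] these letters
   have type [alph th (n + 0)]. *)
Fixpoint unfold_letter (th : directive) (n : nat) : alph th n -> seq (alph th 0) :=
  match n with
  | 0 => fun a => [:: a]
  | m.+1 => fun a => extend (@unfold_letter th m) (morph th m a)
  end.

Section ConstantLength.
Variables (th : directive) (q : nat -> nat).
Hypothesis thq : constant_length th q.

Lemma pp0 : pp q 0 = 1.
Proof. by rewrite /pp big_ord0. Qed.

Lemma ppS n : pp q n.+1 = pp q n * q n.
Proof. by rewrite /pp big_ord_recr. Qed.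

Lemma length_gt0 n : 0 < q n.
Proof.
have /card_gt0P[a _] := alph_gt0 th n.+1.
by rewrite -(thq a) lt0n size_eq0 morph_neq0.
Qed.

Lemma pp_gt0 n : 0 < pp q n.
Proof. by elim: n => [|n IH]; rewrite ?pp0// ppS muln_gt0 IH length_gt0. Qed.

Lemma dvdn_pp m n : m <= n -> pp q m %| pp q n.
Proof.
move=> /subnK <-; elim: (n - m) => // k IH.
by rewrite addSn ppS dvdn_mulr.
Qed.

Lemma ppS_div m k : pp q (k.+1 + m) %/ pp q m = pp q (k + m) %/ pp q m * q (k + m).
Proof. by rewrite addSn ppS divn_mulAC// dvdn_pp// leq_addl. Qed.

Lemma size_unfold_letter n (a : alph th n) : size (unfold_letter a) = pp q n.
Proof.
elim: n a => [|n IH] a /=; first by rewrite pp0.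
by rewrite (size_extend _ IH) thq ppS mulnC.
Qed.

Lemma size_morph_iter m k (a : alph th (k + m)) :
  size (morph_iter a) = pp q (k + m) %/ pp q m.
Proof.
elim: k a => [|k IH] a /=; first by rewrite divnn pp_gt0.
by rewrite (size_extend _ IH) thq ppS_div mulnC.
Qed.

Lemma unfold_morph_iter m k (a : alph th (k + m)) :
  unfold_letter a = extend (@unfold_letter th m) (morph_iter a).
Proof.
elim: k a => [|k IH] a /=; first by rewrite extend_cons cats0.
by rewrite extend_comp; congr flatten; apply: eq_map => b; exact: IH.
Qed.

(** By [hamming_extend], words that differ at level n still differ after theta^[0, n), so equality
    of the unfolded words descends to the images under theta^(n). *)
Lemma unfold_letter_inj n : injective_directive th -> injective (@unfold_letter th n).
Proof.
move=> thI; elim: n => [|n IH] a b /=; first by case.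
have ss w : size (extend (@unfold_letter th n) w) = size w * pp q n.
  exact/size_extend/size_unfold_letter.
move=> ab; apply: thI; apply: contraTeq isT => mab.
have := hamming_gt0 _ mab; rewrite !thq => /(_ erefl).
rewrite ltnNge => /negP; case.
apply: leq_trans (hamming_extend IH (@size_unfold_letter n) _) _; rewrite ?thq//.
rewrite ab; elim: (extend _ _) => // c w.
by rewrite /hamming /= eqxx.
Qed.

(* If all columns had two letters, some two letters of level [k + m] would have
   images under theta^[0, k + m) differing in a proportion [1 / (K p_m)] of the places. *)
Lemma coincidence_column K m k : injective_directive th ->
  #|alph th (k + m)| <= K ->
  (forall b c : alph th (k + m),
     (K * pp q m).+1 * hamming (unfold_letter b) (unfold_letter c) <= pp q (k + m)) ->
  exists2 j, j < pp q (k + m) %/ pp q m & #|column th m k j| <= 1.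
Proof.
move=> thI cK ham.
set P := pp q (k + m) %/ pp q m.
have PE : pp q (k + m) = P * pp q m by rewrite divnK// dvdn_pp// leq_addl.
have P0 : 0 < P by rewrite divn_gt0 ?pp_gt0// dvdn_leq ?pp_gt0// dvdn_pp// leq_addl.
apply: contrapT => nocol.
have {}nocol j : j < P -> 1 < #|column th m k j|.
  by move=> jP; rewrite ltnNge; apply/negP => c1; apply: nocol; exists j.
have /card_gt0P[b0 _] := alph_gt0 th (k + m).
have /card_gt0P[x0 _] := alph_gt0 th m.
have col j : j < P -> exists b : alph th (k + m),
    nth x0 (morph_iter b) j != nth x0 (morph_iter b0) j.
  move=> jP; apply: contrapT => /forallNP nob.
  have := nocol _ jP; rewrite ltnNge => /negP; apply.
  apply/card_le1_eqP => _ _ /imsetP[b _ ->] /imsetP[b' _ ->].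
  have bb0 (c : alph th (k + m)) : onth (morph_iter c) j = Some (nth x0 (morph_iter b0) j).
    have /negP := nob c; rewrite negbK => /eqP <-.
    by rewrite onthE (nth_map x0)// size_morph_iter.
  by rewrite !bb0.
(* Each column has an entry different from that of [b0], so counting disagreements column by column
   gives at least P of them. *)
have H1 : P <= \sum_(b : alph th (k + m)) hamming (morph_iter b) (morph_iter b0).
  under eq_bigr => b _ do rewrite (hamming_sum x0) ?size_morph_iter//.
  rewrite exchange_big /= -[X in X <= _]card_ord -sum1_card.
  apply: leq_sum => j _; have [b bj] := col j (ltn_ord j).
  by rewrite (bigD1 b)//= bj.
have H2 (b : alph th (k + m)) :
    (K * pp q m).+1 * hamming (morph_iter b) (morph_iter b0) <= pp q (k + m).
  apply: (leq_trans _ (ham b b0)); rewrite leq_mul2l /=.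
  rewrite !unfold_morph_iter; apply: (hamming_extend _ (@size_unfold_letter m)).
    exact: unfold_letter_inj.
  by rewrite !size_morph_iter.
(* Summing over at most K letters yields (K p_m + 1) P <= K p_m P, which is absurd since P > 0. *)
have H3 : (K * pp q m).+1 * P <= K * pp q (k + m).
  apply: (@leq_trans (\sum_(b : alph th (k + m)) pp q (k + m))); last first.
    by rewrite sum_nat_const leq_mul2r cK orbT.
  apply: (@leq_trans ((K * pp q m).+1 *
    \sum_(b : alph th (k + m)) hamming (morph_iter b) (morph_iter b0))).
    by rewrite leq_mul2l H1 orbT.
  by rewrite big_distrr /=; apply: leq_sum => b _; exact: H2.
move: H3; rewrite PE [P * _]mulnC mulnA leq_pmul2r//; lia.
Qed.

End ConstantLength.

(** The normalised Hamming distance between level-0 images tends to 0 uniformly over pairs of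
    letters; D plays the role of 1 / epsilon. *)
Definition close_letters (th : directive) (q : nat -> nat) : Prop :=
  forall D, exists n0, forall n, n0 <= n -> forall b c : alph th n,
    D * hamming (unfold_letter b) (unfold_letter c) <= pp q n.

Lemma column_number_inj_le1 th q : constant_length th q ->
  injective_directive th -> bounded_size th -> close_letters th q ->
  column_number_inj th q <= 1.
Proof.
move=> thq thI [K thK] close.
have c1 m : column_number_from th q m <= 1.
  have [n0 near] := close (K * pp q m).+1.
  (* The choice k = n0 + 1 makes k positive, as the infimum requires, and puts level k + m beyond
     n0. *)
  have [|b c|j jP cj] := coincidence_column (K := K) (m := m) (k := n0.+1) thq thI.
  - exact: thK.
  - by apply: near; lia.
  apply: leq_trans cj.
  (* A default value 0 satisfies the bound trivially; otherwise the infimum is at most the size of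
     the column just found. *)
  rewrite /column_number_from /infimum; case: ifPn => // _.
  case: xgetP => // y _ [lby _]; apply: lby.
  by exists n0.+1, j.
rewrite /column_number_inj /supremum; case: ifPn => // _.
case: xgetP => // y _ [_ uby]; apply: uby.
by move=> _ [m _ <-]; exact: c1.
Qed.

(** * Passage to the injectivisation *)

Section Injectivisation.
Variables (th : directive) (q : nat -> nat).
Hypothesis thq : constant_length th q.

Let kappa n : alph th n -> inj_alph th n := projT2 (inj_quotient th n).

Let kappa_surj n (b : inj_alph th n) : exists a, kappa a = b.
Proof.
case: n b => [|n] b; first by exists b.
have /codomP[a ba] := ssvalP b; exists a; exact: val_inj.
Qed.

Lemma injectivisation_constant_length : constant_length (injectivisation th) q.
Proof.
move=> n b; have /codomP[a ba] := ssvalP b.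
by rewrite [morph _ _ _]ba size_map thq.
Qed.

Lemma injectivisation_injective : injective_directive (injectivisation th).
Proof. by move=> n; exact: val_inj. Qed.

Lemma injectivisation_bounded_size : bounded_size th -> bounded_size (injectivisation th).
Proof.
move=> [K thK]; exists K => n; apply: leq_trans (thK n).
have -> : #|inj_alph th n| = #|codom (@kappa n)|.
  by apply: eq_card => b; apply/esym/codomP; have [a <-] := kappa_surj b; exists a.
exact: leq_image_card.
Qed.

(** The maps kappa_n intertwine the two sequences of morphisms and kappa_0 is the identity, so
    identified letters have the same level-0 image. *)
Lemma unfold_letter_injectivisation n (a : alph th n) :
  unfold_letter (kappa a : alph (injectivisation th) n) = unfold_letter a.
Proof.
elim: n a => [//|n IH] a.
transitivity (extend (@unfold_letter (injectivisation th) n)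
  (map (@kappa n) (morph th n a))); first by [].
by rewrite /extend -map_comp; congr flatten; apply: eq_map => b /=; exact: IH.
Qed.

Lemma injectivisation_close : close_letters th q -> close_letters (injectivisation th) q.
Proof.
move=> close D; have [n0 near] := close D; exists n0 => n n0n b c.
have [a <-] := kappa_surj b; have [a' <-] := kappa_surj c.
by rewrite !unfold_letter_injectivisation near.
Qed.

Lemma naive_column_number_le1 : bounded_size th -> close_letters th q ->
  naive_column_number th q <= 1.
Proof.
move=> thK close; rewrite /naive_column_number; case: asboolP => thI.
  exact: column_number_inj_le1.
apply: column_number_inj_le1.
- exact: injectivisation_constant_length.
- exact: injectivisation_injective.
- exact: injectivisation_bounded_size.
- exact: injectivisation_close.
Qed.

End Injectivisation.

(** * The pure base and its blocks in the fibre *)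

Lemma word_cat th n (x : fullshift th n) (s k l : nat) :
  word x s (k + l) = word x s k ++ word x (Posz (s + k)) l.
Proof.
rewrite /word /mkseq iotaD map_cat; congr (_ ++ _).
rewrite -[X in iota X _]addn0 iotaDl -map_comp; apply: eq_map => j /=.
by rewrite PoszD PoszD addrA.
Qed.

Lemma extend_unit {A : Type} (w : seq A) : extend (fun a => [:: a]) w = w.
Proof. by elim: w => // a w IH; rewrite extend_cons IH. Qed.

Section PureBase.
Variables (th : directive) (q : nat -> nat) (h : nat).
Variables (u : forall n, fullshift th n) (bth : directive).
Hypotheses (thq : constant_length th q) (h0 : 0 < h).
Hypothesis uS : forall n, morph_image (u n.+1) (u n).

Lemma unfold_prefix n k :
  extend (@unfold_letter th n) (word (u n) 0 k) = word (u 0) 0 (k * pp q n).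
Proof.
elim: n k => [|n IH] k.
  by rewrite pp0 muln1; exact: extend_unit.
have /= [+ _] := uS n k; rewrite (size_extend _ (@thq n)) size_mkseq => un.
rewrite -[LHS]extend_comp -un IH; congr word.
by rewrite ppS; lia.
Qed.

(** Cancel the prefix of length s p_n in [unfold_prefix] for s + k. *)
Lemma unfold_word n (s k : nat) :
  extend (@unfold_letter th n) (word (u n) s k) = word (u 0) (Posz (s * pp q n)) (k * pp q n).
Proof.
have := unfold_prefix n (s + k).
rewrite mulnDl (word_cat (u n) 0) (word_cat (u 0) 0) extend_cat unfold_prefix.
by move/eqP; rewrite eqseq_cat// eqxx => /eqP.
Qed.

Variable tau : forall n, alph bth n -> seq (alph th n).
Hypothesis tau_inj : forall n, injective (@tau n).
Hypothesis tau_range : forall n,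
  range (@tau n) = [set word (u n) (k * h)%N%:Z h | k in setT].
Hypothesis tau_morph : forall n (b : alph bth n.+1),
  extend (@tau n) (morph bth n b) = extend (morph th n) (tau b).

Lemma size_tau n (b : alph bth n) : size (tau b) = h.
Proof.
have : range (@tau n) (tau b) by exists b.
by rewrite tau_range => -[k _ <-]; rewrite size_mkseq.
Qed.

Lemma pure_base_constant_length : constant_length bth q.
Proof.
move=> n b; have := congr1 size (tau_morph b).
by rewrite (size_extend _ (@size_tau n)) (size_extend _ (@thq n)) size_tau mulnC =>
  /eqP; rewrite eqn_pmul2l// => /eqP.
Qed.

(** Letters of the pure base embed into the words of length h, and h does not depend on the
    level. *)
Lemma pure_base_bounded_size : bounded_size th -> bounded_size bth.
Proof.
move=> [K thK]; exists (K ^ h) => n.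
pose f (b : alph bth n) : h.-tuple (alph th n) := tcast (size_tau b) (in_tuple (tau b)).
have fI : injective f.
  by move=> b c /(congr1 (@tval _ _)); rewrite /f !val_tcast; exact: tau_inj.
apply: leq_trans (leq_card f fI) _.
by rewrite card_tuple leq_exp2r.
Qed.

Lemma unfold_tau n (b : alph bth n) :
  extend (@tau 0) (unfold_letter b) = extend (@unfold_letter th n) (tau b).
Proof.
elim: n b => [|n IH] b /=.
  by rewrite extend_cons cats0; exact/esym/extend_unit.
rewrite extend_comp -[RHS]extend_comp -tau_morph extend_comp.
by congr flatten; apply: eq_map => c; exact: IH.
Qed.

(** Read through [tau], the level-0 image of a letter of level n is a window of [u 0] of length h
    p_n whose position is a multiple of h p_n. For n >= n0 all these positions are therefore 0
    modulo p_n0 h. *)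
Lemma pure_base_close : (forall N, exists n, N <= pp q n) ->
  (forall D, exists n0 L0, forall L, L0 <= L -> forall s t : nat,
    s = t %[mod pp q n0 * h] -> D * hamming (word (u 0) s L) (word (u 0) t L) <= L) ->
  close_letters bth q.
Proof.
(* The extra factor h makes up for the windows being h times longer than the words over the pure
   base. *)
move=> ppoo near D; have [n0 [L0 n0L0]] := near (D * h).
have [n1 n1L0] := ppoo L0.
exists (maxn n0 n1) => n; rewrite geq_max => /andP[n0n n1n] b c.
have L0n : L0 <= h * pp q n.
  apply: leq_trans n1L0 _; apply: leq_trans (leq_pmull _ h0).
  by rewrite dvdn_leq ?(pp_gt0 thq)// dvdn_pp.
have wE (d : alph bth n) : exists k, extend (@tau 0) (unfold_letter d) =
    word (u 0) (Posz (k * (h * pp q n))) (h * pp q n).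
  have : range (@tau n) (tau d) by exists d.
  rewrite tau_range => -[k _ kE]; exists k.
  by rewrite unfold_tau -kE unfold_word mulnA.
have [k kE] := wE b; have [l lE] := wE c.
have blockmod m : m * (h * pp q n) = 0 %[mod pp q n0 * h].
  apply/eqP; rewrite mod0n -/(dvdn _ _); apply: dvdn_mull; rewrite mulnC.
  by rewrite dvdn_mul// dvdn_pp.
have := n0L0 _ L0n (k * (h * pp q n)) (l * (h * pp q n)) _.
rewrite !blockmod => /(_ erefl); rewrite -kE -lE => H.
rewrite -(leq_pmul2l h0); apply: leq_trans H.
rewrite mulnCA mulnA leq_mul2l; apply/orP; right.
apply: (hamming_extend (@tau_inj 0) (@size_tau 0)).
by rewrite !(size_unfold_letter pure_base_constant_length).
Qed.

End PureBase.

Local Open Scope ring_scope.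

(** * Clopen sets and empirical measures *)

(** An alias, so that the algebra of clopen sets, the domain of the premeasure to be extended, can
    coexist with the Borel structure. *)
Definition clopens (T : Type) : Type := T.

HB.instance Definition _ (T : ptopologicalType) := Pointed.on (clopens T).
HB.instance Definition _ (T : ptopologicalType) :=
  @isAlgebraOfSets.Build default_measure_display (clopens T) (@clopen T)
    (@clopen0 T) (@clopenU T) (fun A cA => @clopenC T A A cA).

Section ClopenExtension.
Variables (R : realType) (T : ptopologicalType) (nu : set T -> R).
Hypothesis cT : compact [set: T].
Hypothesis nu_ge0 : forall A, 0 <= nu A.
Hypothesis nuT : nu setT = 1.
Hypothesis nuU : forall A B, clopen A -> clopen B -> A `&` B = set0 ->
  nu (A `|` B) = nu A + nu B.

Definition clopen_content (A : set (clopens T)) : \bar R := (nu A)%:E.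

Lemma clopen_content0 : nu set0 = 0.
Proof.
have := nuU clopen0 clopen0 (set0I _); rewrite setU0.
by move=> /esym/eqP; rewrite -subr_eq0 addrK => /eqP.
Qed.

Let nuS0 : clopen_content set0 = 0%E.
Proof. by rewrite /clopen_content clopen_content0. Qed.

Let nuS_ge0 A : (0 <= clopen_content A)%E.
Proof. by rewrite lee_fin nu_ge0. Qed.

Lemma clopen_content_bigcup (F : nat -> set T) n : (forall i, clopen (F i)) -> trivIset setT F ->
  clopen (\bigcup_(i < n) F i) /\ nu (\bigcup_(i < n) F i) = \sum_(i < n) nu (F i).
Proof.
move=> cF tF; elim: n => [|n [IHc IHn]].
  by rewrite big_ord0 bigcup_mkord big_ord0; split; [exact: clopen0|exact: clopen_content0].
rewrite bigcup_mkord big_ord_recr /= -bigcup_mkord big_ord_recr /=; split.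
  exact: clopenU.
rewrite nuU ?IHn// -subset0 => x [[i /= ilt Fix] Fnx].
have ein : i = n by apply: (tF i n I I); exists x.
by move: ilt; rewrite ein ltnn.
Qed.

Let nuS_sa : semi_sigma_additive clopen_content.
Proof.
move=> F mF tF mUF.
have cF i : clopen (F i : set T) by exact: mF.
(* By compactness, a disjoint clopen family with clopen union has only finitely many non-empty
   members; countable additivity reduces to finite additivity. *)
have [N NF] : exists N, forall i, (N <= i)%N -> F i = set0.
  have : compact (\bigcup_i F i : set T).
    by apply: (subclosed_compact _ cT) => //; case: mUF.
  rewrite compact_cover => /(_ nat setT (F : nat -> set T)) [|//|D _ DF].
    by move=> i _; case: (cF i).
  exists (\max_(i <- finmap.enum_fset D) i).+1 => i iN.
  rewrite -subset0 => x Fix; have [j /= jD Fjx] := DF x (ex_intro2 _ _ i I Fix).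
  have ij : i = j by apply: (tF i j I I); exists x.
  move: iN; rewrite ij ltnNge; apply/negP.
  rewrite negbK.
  exact: (@leq_bigmax_seq _ _ xpredT id).
have UE : \bigcup_i F i = \bigcup_(i < N) F i.
  rewrite eqEsubset; split => x [i _ Fix]; last by exists i.
  by exists i => //=; rewrite ltnNge; apply/negP => /NF F0; move: Fix; rewrite F0.
rewrite /clopen_content UE (clopen_content_bigcup _ cF tF).2.
apply: (@cvg_near_cst); exists N => // n /= Nn.
rewrite -(subnKC Nn) /index_iota subn0 iotaD big_cat /= add0n.
rewrite [X in _ + X]big1_seq ?adde0 => [|i]; last first.
  by rewrite mem_iota => /andP[_ /andP[/NF -> _]]; rewrite clopen_content0.
by rewrite sumEFin -[X in iota 0 X]subn0 -/(index_iota 0 N) big_mkord.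
Qed.

HB.instance Definition _ := isMeasure.Build _ (clopens T) R clopen_content
  nuS0 nuS_ge0 nuS_sa.


Hypothesis borelE : <<s @open T >> = <<s @clopen T >>.

(** The Caratheodory extension lives on the sigma-algebra generated by the clopen sets; [borelE]
    transports it to the Borel sets. *)
Let ext (A : set (borel T)) : \bar R :=
  measure_extension clopen_content (A : set (g_sigma_algebraType (@clopen T))).

Let ext0 : ext set0 = 0%E.
Proof. exact: measure0. Qed.

Let ext_ge0 A : (0 <= ext A)%E.
Proof. exact: measure_ge0. Qed.

Let ext_sa : semi_sigma_additive ext.
Proof.
have mE (A : set (borel T)) : measurable A ->
    measurable (A : set (g_sigma_algebraType (@clopen T))).
  by rewrite /measurable /= borelE.
move=> F mF tF mUF; apply: (@measure_semi_sigma_additive _ _ _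
  (measure_extension clopen_content)) => //; last exact: mE.
by move=> i; exact: mE.
Qed.

HB.instance Definition _ := isMeasure.Build _ (borel T) R ext ext0 ext_ge0 ext_sa.

Let extE (A : set T) : clopen A -> ext A = (nu A)%:E.
Proof. by move=> cA; rewrite /ext /measure_extension /= measurable_mu_extE. Qed.

Let extT : ext setT = 1%E.
Proof. by rewrite extE ?nuT//; exact: clopenT. Qed.

HB.instance Definition _ := Measure_isProbability.Build _ (borel T) R ext extT.

Lemma clopen_extension : exists m : probability (borel T) R,
  forall A : set T, clopen A -> m A = (nu A)%:E.
Proof. by exists ext; exact: extE. Qed.

End ClopenExtension.

(** Enumerate all clopen sets and replace those not inside O by the empty set; zero-dimensionality
    ensures that the rest cover O. *)
Lemma open_clopen_bigcup (T : topologicalType) (O : set T) :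
  hausdorff_space T -> zero_dimensional T -> compact [set: T] ->
  countable (@clopen T) -> open O ->
  exists2 F : nat -> set T, (forall n, clopen (F n) /\ F n `<=` O) & O = \bigcup_n F n.
Proof.
move=> hT zT cT /pfcard_geP[c0|/unsquash g] oO.
  by have := @clopen0 T; rewrite c0.
exists (fun n => if `[< g n `<=` O >] then g n else set0).
  move=> n; case: asboolP => gO; last by split=> //; exact: clopen0.
  by split=> //; exact: (@funS _ _ _ _ g).
rewrite eqEsubset; split => [x Ox|x [n _]]; last by case: asboolP => // gO /gO.
have [A [Ax cA] AO] := zero_dimensional_cvg hT zT cT (open_nbhs_nbhs (conj oO Ox)).
have [n _ gA] := @surj _ _ _ _ g A cA.
by exists n => //; case: asboolP; rewrite gA.
Qed.

Lemma borel_clopenE (T : topologicalType) :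
  hausdorff_space T -> zero_dimensional T -> compact [set: T] ->
  countable (@clopen T) -> <<s @open T >> = <<s @clopen T >>.
Proof.
move=> hT zT cT ctT; rewrite eqEsubset; split; last first.
  by apply: sub_sigma_algebra2 => A [].
apply: smallest_sub; first exact: smallest_sigma_algebra.
move=> O /(open_clopen_bigcup hT zT cT ctT)[F cF ->].
by apply: sigma_algebra_bigcup => n; apply: sub_gen_smallest; exact: (cF n).1.
Qed.

Section UltraLimit.
Variables (R : realType) (U : set_system nat).
Hypotheses (UU : UltraFilter U).

(** Compactness gives a cluster point, and a cluster point of an ultrafilter is a limit. One
    ultrafilter thus serves all sets at once, with no extraction of subsequences. *)
Lemma ultra_cvg01 (a : nat -> R) : (forall n, 0 <= a n <= 1) ->
  cvg (a n @[n --> U]).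
Proof.
move=> a01.
have : compact `[0 : R, 1]%classic by exact: segment_compact.
move=> /(_ (a @ U) _)[|l [_ al]].
  by apply: (@filterE _ U) => n; rewrite /preimage /= in_itv /=; exact: a01.
apply/cvg_ex; exists l => B Bl.
have [//|UB] := in_ultra_setVsetC (a @^-1` B) UU.
by have [z [nB /nB]] := al (~` B) B UB Bl.
Qed.

End UltraLimit.

Section Empirical.
Variables (R : realType) (T : ptopologicalType) (S : T -> T) (x : T).

Definition hits (A : set T) (s L : nat) : R := \sum_(i < L) \1_A (iter (s + i) S x).

Lemma hits_bound A s L : 0 <= hits A s L <= L%:R.
Proof.
rewrite /hits; apply/andP; split; first by apply: sumr_ge0 => i _; rewrite indicE.
rewrite -[leRHS]/(1 *+ L) -[X in 1 *+ X]card_ord -sumr_const; apply: ler_sum => i _.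
by rewrite indicE; case: (_ \in _).
Qed.

Lemma hitsU A B s L : A `&` B = set0 -> hits (A `|` B) s L = hits A s L + hits B s L.
Proof.
move=> AB0; rewrite /hits -big_split /=; apply: eq_bigr => i _.
rewrite !indicE in_setU -natrD; congr (_%:R).
have [xA|] := boolP (_ \in A); have [xB|] // := boolP (_ \in B).
by have : (A `&` B) (iter (s + i) S x); [split; exact: set_mem|rewrite AB0].
Qed.

Lemma hits_preimage A s L : hits (S @^-1` A) s L = hits A s.+1 L.
Proof. by apply: eq_bigr => i _; rewrite !indicE. Qed.

(** The two counts share all but their extreme terms. *)
Lemma hits_shift A s L : `|hits A s.+1 L - hits A s L| <= 1.
Proof.
have E : hits A s L + \1_A (iter (s + L) S x) = \1_A (iter s S x) + hits A s.+1 L.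
  transitivity (hits A s L.+1); first by rewrite /hits big_ord_recr.
  rewrite /hits big_ord_recl addn0; congr (_ + _); apply: eq_bigr => i _.
  by rewrite /= /bump /= ?add1n ?addnS.
have -> : hits A s.+1 L - hits A s L = \1_A (iter (s + L) S x) - \1_A (iter s S x).
  by apply/eqP; rewrite subr_eq addrAC eq_sym subr_eq addrC [X in _ == X]addrC -E addrC.
rewrite !indicE; case: (_ \in _); case: (_ \in _);
  by rewrite ?subrr ?subr0 ?sub0r ?normrN ?normr1 ?normr0.
Qed.

End Empirical.

Section UniformVisits.
Variables (R : realType) (T : ptopologicalType) (S : T -> T).
Hypotheses (hT : hausdorff_space T) (zT : zero_dimensional T).
Hypotheses (cT : compact [set: T]) (ctT : countable (@clopen T)).
Hypothesis clopenS : forall A, clopen A -> clopen (S @^-1` A).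

(** The clopen sets are stable under intersection and generate the Borel sets, so [m] and its image
    under S agree as soon as they agree on clopen sets. *)
Lemma invariant_clopen (m : probability (borel T) R) :
  (forall A : set T, clopen A -> m (S @^-1` A) = m A) -> invariant_measure S m.
Proof.
move=> mS A mA.
have bE := borel_clopenE hT zT cT ctT.
have mSf : measurable_fun [set: borel T] (S : borel T -> borel T).
  apply: (@measurability _ _ (borel T) (borel T) _ _
    (@clopen T : set (set (borel T)))); first exact: bE.
  move=> _ [B cB <-]; rewrite setTI; apply: sub_sigma_algebra.
  by case: (clopenS cB).
rewrite -[LHS]/(pushforward m (S : borel T -> borel T) A).
apply: (@measure_unique _ R (borel T) (@clopen T) (fun=> setT) bE (@clopenI T) _ _
  (pushforward m (S : borel T -> borel T)) m) => //.
- by move=> _; exact: clopenT.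
- by rewrite bigcup_const//; exists 0.
- by move=> _; apply: (le_lt_trans (probability_le1 m measurableT)); rewrite ltry.
Qed.

Variables (mu : probability (borel T) R) (X : set T) (x : T).
Hypotheses (cX : closed X) (Xx : forall i, X (iter i S x)).
Hypothesis ue : unique_invariant_measure S mu X.

(* Otherwise an ultralimit of empirical measures along longer and longer windows
   is a second invariant measure on [X]. *)
Lemma uniform_visits (A : set T) (e : R) : clopen A -> (mu A < e%:E)%E ->
  exists L0, forall L, (L0 <= L)%N -> forall s, hits R S x A s L <= e * L%:R.
Proof.
move=> cA mAe; apply: contrapT => /forallNP noL.
have /choice[f fP] k : exists sL : nat * nat,
    (k <= sL.2)%N /\ e * sL.2%:R < hits R S x A sL.1 sL.2.
  have /existsNP[L /not_implyP[kL /existsNP[s /negP]]] := noL k.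
  by rewrite -ltNge => h; exists (s, L).
pose s k := (f k).1; pose L k := (f k).2.
have Lk k : (k <= L k)%N by case: (fP k).
have L0 k : (0 < L k)%N.
  case: (fP k) => _; rewrite -/(L k); case: (L k) => //.
  by rewrite mulr0 /hits big_ord0 ltxx.
(* A free ultrafilter: it contains every cofinite tail, along which the window lengths L k go to
   infinity. *)
have [U [UU oU]] := ultraFilterLemma (eventually_filter).
pose emp k B : R := hits R S x B (s k) (L k) / (L k)%:R.
have emp01 B k : 0 <= emp k B <= 1.
  have /andP[h0 h1] := hits_bound R S x B (s k) (L k).
  by rewrite divr_ge0//= ler_pdivrMr ?ltr0n// mul1r.
have empcvg B : cvg (emp k B @[k --> U]) by exact: ultra_cvg01.
pose nu B := lim (emp k B @[k --> U]).
have nu_ge0 B : 0 <= nu B.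
  by apply: limr_ge => //; apply: nearW => k; case/andP: (emp01 B k).
have nu1 B : (forall i, B (iter i S x)) -> nu B = 1.
  move=> Bx; rewrite /nu (_ : emp^~ B = cst 1) ?lim_cst// funeqE => k.
  rewrite /emp /hits (eq_bigr (fun=> 1)) => [|i _]; last by rewrite indicE mem_set.
  by rewrite sumr_const card_ord divff// pnatr_eq0 -lt0n.
have nuU B C : clopen B -> clopen C -> B `&` C = set0 -> nu (B `|` C) = nu B + nu C.
  move=> _ _ BC0; rewrite /nu -limD//.
  rewrite (_ : emp^~ _ = emp^~ B \+ emp^~ C)// funeqE => k.
  by rewrite /emp hitsU// mulrDl.
(* Shifting a window changes its count by at most 1, which is negligible against L k. *)
have nuS B : nu (S @^-1` B) = nu B.
  apply/eqP; rewrite -subr_eq0; apply/eqP; rewrite /nu -limB//.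
  apply/cvg_lim => //.
  apply/cvgr0Pnorm_le => e' e'0.
  apply: (oU [set k | `|emp k (S @^-1` B) - emp k B| <= e']).
  exists (Num.bound e'^-1) => // k /= kb.
  rewrite /emp -mulrBl hits_preimage normrM.
  apply: (@le_trans _ _ (1 * (L k)%:R^-1)).
    by rewrite normfV normr_nat ler_wpM2r// ?invr_ge0// hits_shift.
  rewrite mul1r -[leRHS]invrK lef_pV2 ?posrE ?invr_gt0 ?ltr0n//.
  apply: ltW; apply: lt_le_trans (archi_boundP _) _; first by rewrite invr_ge0 ltW.
  by rewrite ler_nat (leq_trans kb).
have [m mE] := clopen_extension cT nu_ge0 (nu1 _ (fun=> I)) nuU (borel_clopenE hT zT cT ctT).
have minv : invariant_measure S m.
  apply: invariant_clopen => B cB; rewrite !mE//; last exact: clopenS.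
  by rewrite nuS.
have nu0 B : (forall i, ~ B (iter i S x)) -> nu B = 0.
  move=> Bx; rewrite /nu (_ : emp^~ B = cst 0) ?lim_cst// funeqE => k.
  rewrite /emp /hits big1 ?mul0r// => i _.
  by rewrite indicE memNset.
have bmeas (B : set T) : open B -> measurable (B : set (borel T)).
  by move=> oB; exact: sub_sigma_algebra.
(* The complement of X is a countable union of clopen sets that the orbit never visits, hence
   null. *)
have mX : m X = 1%E.
  have oXC : open (~` X) by exact: closed_openC.
  have mXC : m (~` X) = 0%E.
    apply/negligibleP; first exact: bmeas.
    have [F cF ->] := open_clopen_bigcup hT zT cT ctT oXC.
    apply: negligible_bigcup => n; have [cFn FX] := cF n.
    apply/negligibleP; first by apply: bmeas; case: cFn.
    by rewrite [LHS]mE// nu0// => i /FX; exact.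
  by rewrite -[X]setCK probability_setC ?mXC ?sube0//; exact: bmeas.
have [_ _ /(_ m minv mX A)] := ue.
rewrite [X in X = _]mE// => h.
have : (mu A < e%:E)%E by [].
rewrite -h; last by apply: bmeas; case: cA.
rewrite lte_fin ltNge => /negP; apply.
(* Every chosen window visits A with frequency above e, so the limit is at least e, against
   [mu A < e]. *)
apply: limr_ge => //; apply: nearW => k.
rewrite /emp ler_pdivlMr ?ltr0n//; apply: ltW.
by case: (fP k).
Qed.

End UniformVisits.

(** * The full shift *)

Section FullshiftTopology.
Variables (th : directive) (n : nat).
Notation T := (fullshift th n).

Lemma fullshift_hausdorff : hausdorff_space T.
Proof.
apply: (@hausdorff_product _ (fun _ : int => discrete_topology (alph th n))) => _.
exact: discrete_hausdorff.
Qed.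

Lemma fullshift_zero_dimensional : zero_dimensional T.
Proof.
apply: (@zero_dimension_prod _ (fun _ : int => discrete_topology (alph th n))) => _.
exact: discrete_zero_dimension.
Qed.

Lemma fullshift_compact : compact [set: T].
Proof.
have := @tychonoff _ (fun _ : int => discrete_topology (alph th n)) (fun=> setT).
rewrite (_ : [set f | _] = setT); last by rewrite -subTset => x _.
by apply => _; apply: finite_compact; exact: finite_finset.
Qed.


Lemma coord_clopen (i : int) (B : set (alph th n)) : clopen [set x : T | B (x i)].
Proof.
apply: (@preimage_clopen T (discrete_topology (alph th n)) (fun x : T => x i) B).
  by split; [exact: discrete_open|exact: discrete_closed].
exact: (@proj_continuous _ (fun _ : int => discrete_topology (alph th n)) i).
Qed.
End FullshiftTopology.

(* The full shift with the metric structure of a countable product of discrete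
   spaces, from which second countability is obtained. *)
Definition metric_shift (R : realType) (th : directive) (n : nat) : Type := fullshift th n.

HB.instance Definition _ R th n := Pointed.on (@metric_shift R th n).
HB.instance Definition _ R th n := PseudoMetric.copy (@metric_shift R th n)
  (prod_topology (fun _ : int => discrete_topology (alph th n) : pseudoMetricType R)).

Lemma fullshift_countable_clopen (R : realType) th n : countable (@clopen (fullshift th n)).
Proof.
apply: clopen_countable; first exact: fullshift_compact.
exact: (@compact_second_countable R (@metric_shift R th n) (@fullshift_compact th n)).
Qed.

Lemma iter_shift_map th n (x : fullshift th n) (i : nat) (j : int) :
  iter i (@shift_map th n) x j = x (j + i%:Z).
Proof.
elim: i j => [|i IH] j; first by rewrite addr0.
by rewrite iterS /shift_map IH -addrA; congr (x (_ + _)); lia.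
Qed.

(** Basic neighbourhoods are finite intersections of cylinders, so it suffices to test one
    coordinate at a time. *)
Lemma prod_topology_cvg (I : Type) (K : I -> topologicalType)
    (F : set_system (prod_topology K)) (f : prod_topology K) : Filter F ->
  (forall i (N : set (K i)), open N -> N (f i) -> F [set g | N (g i)]) ->
  F --> f.
Proof.
move=> FF FN U [] P [] [] Q QfinP <- [] V JV Vf /filterS; apply.
apply: (@filterS _ _ _ V); first by exists V.
have [L Lsub /[dup] VL <-] := QfinP _ JV.
apply: filter_bigI => /= M /[dup] LM /Lsub /set_mem [] i _ [N oN] NM.
rewrite -NM; apply: FN => //.
by move: Vf; rewrite -VL => /(_ _ LM); rewrite -NM.
Qed.

Lemma shift_map_continuous th n : continuous (@shift_map th n).
Proof.
move=> x.
apply: (@prod_topology_cvg _ (fun _ : int => discrete_topology (alph th n))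
  (@shift_map th n y @[y --> x]) (shift_map x)) => [|i N _ Nx].
  by apply: fmap_filter; exact: nbhs_filter.
by apply: open_nbhs_nbhs; split=> //; exact: (coord_clopen (i + 1) N).1.
Qed.

Lemma word_shift th n (x : fullshift th n) i l : word (shift_map x) i l = word x (i + 1) l.
Proof. by apply: eq_mkseq => j; rewrite /shift_map addrAC. Qed.

Lemma subshift_shift th n (x : fullshift th n) : subshift th n (shift_map x) <-> subshift th n x.
Proof.
split=> sx i l; last by rewrite word_shift.
by have := sx (i - 1) l; rewrite word_shift subrK.
Qed.

Lemma subshift_iter th n (x : fullshift th n) i :
  subshift th n x -> subshift th n (iter i (@shift_map th n) x).
Proof. by move=> sx; elim: i => //= i IH; exact/subshift_shift. Qed.

(** Membership constrains finite words only, and each finite word is locally constant in x. *)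
Lemma subshift_closed th n : closed (subshift th n).
Proof.
move=> x cx i l.
have nW : nbhs x [set y : fullshift th n | word y i l = word x i l].
  elim: l => [|l IH]; first by apply: filterE.
  apply: filterS2 IH (open_nbhs_nbhs (conj (coord_clopen (i + l%:Z) [set x (i + l%:Z)]).1 erefl)).
  by move=> y /= IH yx; rewrite /word !mkseqS yx; congr rcons.
by have [y [Xy yx]] := cx _ nW; have := Xy i l; rewrite yx.
Qed.

(** Finitely many clopen sets missing the rest of X cover A by compactness. This turns relatively
    clopen subsets of the subshift into clopen sets of the full shift, as [uniform_visits]
    demands. *)
Lemma clopen_trace (T : ptopologicalType) (X A : set T) :
  hausdorff_space T -> zero_dimensional T -> compact [set: T] ->
  closed A -> closed (X `\` A) -> A `<=` X -> exists2 C, clopen C & C `&` X = A.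
Proof.
move=> hT zT cT cA cXA AX.
have /choice[F FP] (x : T) : exists C : set T, clopen C /\ (A x -> C x /\ C `&` (X `\` A) = set0).
  have [Ax|nAx] := pselect (A x); last by exists set0; split=> //; exact: clopen0.
  have nx : nbhs x (~` (X `\` A)).
    by apply: open_nbhs_nbhs; split; [exact: closed_openC|move=> [_]; exact].
  have [C [Cx cC] CA] := zero_dimensional_cvg hT zT cT nx.
  exists C; split=> // _; split=> //.
  by rewrite -subset0 => y [/CA nXA].
have : cover_compact A by rewrite -compact_cover; exact: (subclosed_compact cA cT).
move=> /(_ T A F)[x Ax|x Ax|D DA DF].
- by have [[]] := FP x.
- by exists x => //; exact: ((FP x).2 Ax).1.
exists (\bigcup_(x in [set` D]) F x).
  rewrite bigcup_fset; elim/big_ind: _ => [|B C|x _]; [exact: clopen0|exact: clopenU|].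
  exact: (FP x).1.
rewrite eqEsubset; split => [y [[x xD Fy] Xy]|y Ay]; last by split; [exact: DF|exact: AX].
apply: contrapT => nAy.
have /= xA : A x by apply: set_mem; exact: DA.
by have := ((FP x).2 xA).2; rewrite -subset0 => /(_ y); apply.
Qed.

(** * Continuous eigenvalues *)

Lemma normc_ReIm {R : rcfType} (z : R[i]) :
  [/\ `|complex.Re z| <= normc z, `|complex.Im z| <= normc z
    & normc z <= `|complex.Re z| + `|complex.Im z|].
Proof.
case: z => a b /=; split.
- by rewrite -sqrtr_sqr ler_sqrt ?addr_ge0 ?sqr_ge0// lerDl sqr_ge0.
- by rewrite -sqrtr_sqr ler_sqrt ?addr_ge0 ?sqr_ge0// lerDr sqr_ge0.
- have -> : `|a| + `|b| = Num.sqrt ((`|a| + `|b|) ^+ 2).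
    by rewrite sqrtr_sqr [RHS]ger0_norm ?addr_ge0.
  rewrite ler_sqrt ?sqr_ge0//.
  by rewrite sqrrD !real_normK ?num_real// lerD2r lerDl mulrn_wge0// mulr_ge0.
Qed.

(* The distance of [z ^+ (2 ^ k)] to 1 grows at least geometrically while it is at most 1/2. *)
Lemma root_of_unity_near1 {R : realType} (z : R[i]) :
  (forall k, normc (z ^+ k - 1) <= 1 / 2) -> z = 1.
Proof.
move=> zk.
have grow k : (1 + k%:R / 2) * normc (z - 1) <= normc (z ^+ (2 ^ k) - 1).
  elim: k => [|k IH]; first by rewrite mul0r addr0 mul1r expr1.
  set w := z ^+ (2 ^ k) in IH *.
  have -> : z ^+ (2 ^ k.+1) - 1 = (w - 1) * (w + 1).
    by rewrite expnS mulnC exprM -/w; ring.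
  rewrite normcM.
  have w1 : 3 / 2 <= normc (w + 1).
    have : normc (1 + 1 : R[i]) <= normc (w + 1) + normc (- (w - 1)).
      by apply: le_trans (le_normcD _ _); rewrite (_ : w + 1 + _ = 1 + 1)//; ring.
    rewrite normcN -mulr2n normcMn normc1.
    have := zk (2 ^ k)%N; rewrite -/w; lra.
  have n0 (y : R[i]) : 0 <= normc y by case: y => a b; exact: sqrtr_ge0.
  have := n0 (z - 1); have := n0 (w - 1).
  set d := normc (z - 1) in IH *; set c := normc (w - 1) in IH *.
  move=> c0 d0; apply: le_trans (ler_wpM2l c0 w1).
  have kd : 0 <= k%:R * d :> R by rewrite mulr_ge0.
  have -> : k.+1%:R = k%:R + 1 :> R by rewrite natr1.
  by move: IH kd c0 d0; lra.
apply/eqP; rewrite -subr_eq0; apply/eqP/eq0_normc/eqP.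
have n0 : 0 <= normc (z - 1) by case: (z - 1) => a b; exact: sqrtr_ge0.
rewrite eq_le n0 andbT leNgt; apply/negP => d0.
set d := normc (z - 1) in d0 grow *.
have := archi_boundP (ltW (_ : 0 < d^-1)); rewrite invr_gt0 => /(_ d0) hk.
have := le_trans (grow (Num.bound d^-1)) (zk _).
have : 1 < (Num.bound d^-1)%:R * d by rewrite -ltr_pdivrMr// div1r.
by nra.
Qed.

(* The complex plane; [R * R] itself does not have the structure of a pointed
   uniform space. *)
Definition plane (R : realType) : Type := (R^o * R^o)%type.
HB.instance Definition _ (R : realType) := Uniform.copy (plane R) (R^o * R^o)%type.
HB.instance Definition _ (R : realType) := isPointed.Build (plane R) (0, 0).

Definition plane_mul (R : realType) (lam : R[i]) (v : plane R) : plane R :=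
  let w := lam * Complex v.1 v.2 in (complex.Re w, complex.Im w).

Lemma iter_plane_mul (R : realType) (lam : R[i]) n v :
  iter n (plane_mul lam) v = plane_mul (lam ^+ n) v.
Proof.
elim: n => [|n IH] /=; first by rewrite /plane_mul mul1r; case: v.
rewrite IH /plane_mul exprS -mulrA.
by case: (lam ^+ n * _).
Qed.

Lemma normc_ge0 {R : rcfType} (z : R[i]) : 0 <= normc z.
Proof. by case: z => a b; exact: sqrtr_ge0. Qed.

(** All powers of [lam] have modulus 1, so all iterates are isometries for the Euclidean
    distance. *)
Lemma plane_equicontinuous (R : realType) (lam : R[i]) (K : set (plane R)) :
  normc lam = 1 ->
  equicontinuous [set: nat] (fun n => (iter n (plane_mul lam) : subspace K -> plane R)).
Proof.
move=> l1 v E entE.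
have [e /= e0 eE] : exists2 e : R, 0 < e & [set xy | ball (xy.1 : (R^o * R^o)%type) e xy.2] `<=` E.
  move: entE; rewrite -[entourage]/(@entourage (R^o * R^o)%type) -entourage_ballE.
  by case=> e e0 eE; exists e.
(* Half of e suffices because the modulus is at most the sum of the two coordinate distances. *)
have nE : nbhs (v : plane R) [set w : plane R | ball (v : (R^o * R^o)%type) (e / 2) w].
  by apply: (@nbhsx_ballx R (R^o * R^o)%type); rewrite divr_gt0.
apply: (nbhs_subspace_subset (@subsetT _ K)); rewrite nbhs_subspaceT.
apply: filterS nE.
move=> w [/= vw1 vw2] n _; apply: eE => /=.
rewrite !iter_plane_mul.
have ln : normc (lam ^+ n) = 1.
  elim: n => [|n IH]; first by rewrite normc1.
  by rewrite exprS normcM l1 IH mulr1.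
move: (lam ^+ n) ln => z z1.
have zvw : normc (z * (Complex v.1 v.2 - Complex w.1 w.2)) < e.
  rewrite normcM z1 mul1r.
  have [_ _ /=] := normc_ReIm (Complex v.1 v.2 - Complex w.1 w.2).
  move/le_lt_trans; apply.
  by rewrite [e]splitr; apply: ltrD.
have [re im _] := normc_ReIm (z * (Complex v.1 v.2 - Complex w.1 w.2)).
split; rewrite /ball /= /plane_mul /=.
  apply: le_lt_trans zvw; apply: le_trans re; rewrite mulrBr raddfB /=.
  by [].
apply: le_lt_trans zvw; apply: le_trans im; rewrite mulrBr raddfB /=.
by [].
Qed.

Lemma Zmod_succ m (a : Zmod m) : (0 < m)%N -> ((a + inZp 1)%R : Zmod m) = (a + 1)%N %[mod m].
Proof. by case: m a => // m a _; rewrite /= modn_mod modnDmr. Qed.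

Lemma Zmod_inj m (a b : Zmod m) : (0 < m)%N -> (a : nat) = b %[mod m] -> a = b.
Proof.
case: m a b => // m a b _ ab; apply: val_inj.
by move: ab; rewrite !modn_small.
Qed.

Section Odometer.
Variables (th : directive) (q : nat -> nat) (h : nat).
Hypotheses (thq : constant_length th q) (h0 : (0 < h)%N).


Lemma rotation_iter (z : odometer_space q h) k :
  (forall n : nat, ((iter k (@rotation q h) z).1 n : Zmod (pp q n)) =
     ((z.1 n : Zmod (pp q n)) + k)%N %[mod pp q n]) /\
  (((iter k (@rotation q h) z).2 : Zmod h) = ((z.2 : Zmod h) + k)%N %[mod h]).
Proof.
elim: k => [|k [IH1 IH2]]; first by split => [n|]; rewrite addn0.
split=> [n|]; rewrite iterS /rotation.
  by rewrite Zmod_succ ?(pp_gt0 thq)// -modnDml IH1 modnDml addn1 addnS.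
by rewrite Zmod_succ// -modnDml IH2 modnDml addn1 addnS.
Qed.

Lemma rotation_period (z : odometer_space q h) n m k : (m <= n)%N ->
  (pp q n * h %| k)%N ->
  (iter k (@rotation q h) z).1 m = z.1 m /\ (iter k (@rotation q h) z).2 = z.2.
Proof.
move=> mn nk; have [E1 E2] := rotation_iter z k; split.
  apply: (@Zmod_inj (pp q m)); first exact: (pp_gt0 thq).
  rewrite E1 -modnDmr (_ : k %% pp q m = 0)%N ?addn0//; apply/eqP.
  by apply: dvdn_trans nk; rewrite dvdn_mulr// dvdn_pp.
apply: (@Zmod_inj h) => //.
rewrite E2 -modnDmr (_ : k %% h = 0)%N ?addn0//; apply/eqP.
by apply: dvdn_trans nk; rewrite dvdn_mull.
Qed.

(** The image of f under multiplication by [lam] is an equicontinuous factor, so f factors through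
    the odometer by a continuous [phi]. Rotating by multiples of p_n h tends to the identity there,
    so the corresponding powers of [lam] tend to 1; if no lam^(p_n h) were 1, suitable multiples
    would keep them away from 1. *)
Lemma eigenvalue_root (R : realType) (lam : R[i]) : is_height th q h ->
  `|lam| = 1 ->
  has_continuous_eigenfunction (subshift th 0) (@shift_map th 0) lam ->
  exists n, lam ^+ (pp q n * h) = 1.
Proof.
move=> [_ _ [_ [pi [_ piX piS] univ]]] l1 [f [cRe cIm [x0 Xx0 fx0] fS]].
have nl1 : normc lam = 1 by case: l1 => <-; rewrite /=; case: (lam) => a b.
pose X := subshift th 0; pose S := @shift_map th 0.
pose g (x : fullshift th 0) : plane R := (complex.Re (f x), complex.Im (f x)).
have cg : {within X, continuous g}.
  move=> x; apply: (@cvg_pair _ _ _ _ (nbhs (complex.Re (f x))) (nbhs (complex.Im (f x)))).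
    exact: cRe.
  exact: cIm.
have gS x : X x -> g (S x) = plane_mul lam (g x).
  by move=> Xx; rewrite /g fS// /plane_mul; case: (f x).
have [phi [cphi _ phiS] phiE] : exists2 phi : odometer_space q h -> plane R,
    factor_map (@odometer q h) (@rotation q h) (g @` X) (plane_mul lam) phi &
    forall x, X x -> g x = phi (pi x).
  apply: univ; last by split.
  split.
  - exact: (@norm_hausdorff R (R^o * R^o)%type).
  - apply: continuous_compact cg _; apply: subclosed_compact (@fullshift_compact _ _) _ => //.
    exact: subshift_closed.
  - by move=> _ [_ [x Xx <-] <-]; exists (S x); [exact/subshift_shift|exact: gS].
  - exact: plane_equicontinuous.
apply: contrapT => /forallNP nlam.
have /choice[k kP] n : exists k, 1 / 2 < normc (lam ^+ (pp q n * h * k) - 1).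
  apply: contrapT => /forallNP nk; apply: (nlam n); apply: root_of_unity_near1 => k.
  by have /negP := nk k; rewrite -leNgt exprM.
pose m n := (pp q n * h * k n)%N.
have Xm i : X (iter i S x0) by exact: subshift_iter.
have fm i : f (iter i S x0) = lam ^+ i * f x0.
  by elim: i => [|i IH]; rewrite ?mul1r// iterS [LHS](fS _ (Xm i)) IH mulrA -exprS.
have pim i : pi (iter i S x0) = iter i (@rotation q h) (pi x0).
  by elim: i => //= i <-; exact: (piS _ (Xm i)).
(* From n = i on, the i-th coordinate and the Z/h coordinate agree with those of [pi x0]. *)
have zcvg : pi (iter (m n) S x0) @[n --> \oo] --> pi x0.
  have zE n i : (i <= n)%N -> (pi (iter (m n) S x0)).1 i = (pi x0).1 i /\
      (pi (iter (m n) S x0)).2 = (pi x0).2.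
    by move=> ?; rewrite pim; apply: (@rotation_period _ n) => //; exact: dvdn_mulr.
  have c1 : (fun n => (pi (iter (m n) S x0)).1) @ \oo --> (pi x0).1.
    apply: prod_topology_cvg => i N _ Ni; exists i => // n /= ni.
    by rewrite (zE _ _ ni).1.
  move=> A [[P Q] /= [nP nQ] PQA].
  have [N _ PN] := c1 P nP; exists N => // n /= /PN /= Pn.
  have : Q (pi (iter (m n) S x0)).2.
    by rewrite (zE n 0%N _).2//; exact: nbhs_singleton.
  by move=> Qn; have := PQA (_, _) (conj Pn Qn); rewrite -surjective_pairing.
have odo x : X x -> odometer (pi x) by move=> Xx; rewrite -piX; exists x.
(* Two coordinates within d give a distance at most |f x0| / 2, that is |lam^(m N) - 1| <= 1/2. *)
pose d := normc (f x0) / 4.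
have d0 : 0 < d.
  rewrite divr_gt0// lt_neqAle normc_ge0 andbT eq_sym.
  by apply: contra fx0 => /eqP/eq0_normc ->.
have /(_ _ (@nbhsx_ballx R (R^o * R^o)%type (phi (pi x0)) d d0)) :=
  (@subspace_continuousP _ _ _ phi).1 cphi (pi x0) (odo _ Xx0).
move=> /zcvg [N _ /(_ N (leqnn N))] /= /(_ (odo _ (Xm _))).
rewrite -!phiE// => -[]; rewrite /ball /= => b1 b2.
have := kP N; rewrite -/(m N) ltNge => /negP; apply.
rewrite -(ler_pM2r (lt_le_trans d0 _ : 0 < normc (f x0))); last first.
  by rewrite /d; have := normc_ge0 (f x0); lra.
rewrite -normcM mulrBl (mul1r (f x0)) -fm.
have [_ _] := normc_ReIm (f (iter (m N) S x0) - f x0).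
move/le_trans; apply; rewrite !raddfB /=.
by move: b1 b2; rewrite /= !(distrC (_ (f x0))) /d; lra.
Qed.

End Odometer.

(** * Ergodicity and the span of the eigenfunctions *)

Lemma ae_measure_le d (T : measurableType d) (R : realType)
    (mu : {measure set T -> \bar R}) (A B : set T) :
  measurable A -> measurable B -> {ae mu, forall x, A x -> B x} -> (mu A <= mu B)%E.
Proof.
move=> mA mB [N [mN N0 AB]].
apply: (@le_trans _ _ (mu (B `|` N))).
  apply: le_measure; rewrite ?inE//; first exact: measurableU.
  move=> x Ax; have [Bx|nBx] := pselect (B x); first by left.
  by right; apply: AB => /= /(_ Ax).
by have := measureU2 mu mB mN; rewrite [X in (_ + X)%E]N0 adde0.
Qed.

Lemma ae_measure_eq d (T : measurableType d) (R : realType)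
    (mu : {measure set T -> \bar R}) (A B : set T) :
  measurable A -> measurable B -> {ae mu, forall x, A x <-> B x} -> mu A = mu B.
Proof.
move=> mA mB AB; apply/eqP; rewrite eq_le; apply/andP; split;
  by apply: ae_measure_le => //; apply: filterS AB => x [].
Qed.

Section Ergodic.
Variables (R : realType) (T : ptopologicalType) (S : T -> T) (X : set T).
Variable mu : probability (borel T) R.
Hypothesis mX : measurable (X : set (borel T)).
Hypothesis mS : measurable_fun [set: borel T] (S : borel T -> borel T).
Hypothesis ue : unique_invariant_measure S mu X.

Lemma measurable_preimage (A : set (borel T)) :
  measurable A -> measurable (S @^-1` A : set (borel T)).
Proof. by move=> mA; rewrite -[X in measurable X]setTI; exact: mS. Qed.

Lemma measurable_iter_preimage j (A : set (borel T)) :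
  measurable A -> measurable (iter j S @^-1` A : set (borel T)).
Proof.
move=> mA; elim: j => // j /measurable_preimage.
by congr measurable; apply/funext => x; rewrite /preimage /= -iterSr.
Qed.

(** If B has positive measure, the normalised restriction of [mu] to B is invariant and carried by
    X, hence equals [mu]; it gives B mass 1. *)
Lemma unique_ergodic (B : set (borel T)) : measurable B ->
  {ae mu, forall x : borel T, B (S x) <-> B x} -> mu B = 0%E \/ mu B = 1%E.
Proof.
move=> mB BS; have [inv X1 uni] := ue.
have [B0|B0] := eqVneq (mu B) 0%E; [by left|right].
have Bfin : (mu B < +oo)%E by rewrite (le_lt_trans (probability_le1 mu mB))// ltry.
pose nu := mnormalize (mrestr mu mB) mu.
have nuE A : nu A = (mu (A `&` B) * ((fine (mu B))^-1)%:E)%E.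
  have rT : mrestr mu mB setT = mu B by rewrite /mrestr setTI.
  by rewrite /nu /mnormalize /= rT (negbTE B0) (lt_eqF Bfin).
have inv_nu : invariant_measure S nu.
  move=> A mA; rewrite -[LHS]/(nu _) -[RHS]/(nu _) !nuE; congr (_ * _)%E.
  rewrite -(inv (A `&` B)); last exact: measurableI.
  apply: ae_measure_eq.
  - by apply: measurableI => //; exact: measurable_preimage.
  - by apply: measurable_preimage; exact: measurableI.
  - by apply: filterS BS => x /= [? ?]; split=> -[? ?]; split=> //; auto.
have Bf : mu B \is a fin_num by rewrite ge0_fin_numE.
have BB : (mu B * ((fine (mu B))^-1)%:E = 1)%E.
  by rewrite -{1}(fineK Bf) -EFinM divff// fine_eq0.
have nuX : nu X = 1%E.
  rewrite nuE (_ : mu (X `&` B) = mu B)//.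
  apply: ae_measure_eq => //; first exact: measurableI.
  exists (~` X); split; [exact: measurableC| |].
    by rewrite [LHS](probability_setC mu mX) X1 subee.
  by move=> x /= nx Xx; apply: nx; split=> [[]|].
by rewrite -(uni nu inv_nu nuX B mB) -[LHS]/(nu _) nuE setIid BB.
Qed.

(* The union of the preimages of [D `&` G] under the first [M] iterates of [S] is
   invariant up to a null set and meets [D] in [D `&` G]. *)
Lemma phase_dichotomy (D G : set (borel T)) (M : nat) : (0 < M)%N ->
  measurable D -> measurable G ->
  (forall x j, D x -> D (iter j S x) -> (M %| j)%N) ->
  (forall x, D (iter M S x) <-> D x) ->
  {ae mu, forall x : borel T, G (iter M S x) <-> G x} ->
  mu (D `&` G) = 0%E \/ mu (D `\` G) = 0%E.
Proof.
move=> M0 mD mG DM DS GS.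
have mDG : measurable (D `&` G) by exact: measurableI.
pose B : set (borel T) := \bigcup_(j in [set j | (j < M)%N]) (iter j S @^-1` (D `&` G)).
have mB : measurable B by apply: bigcup_measurable => j _; exact: measurable_iter_preimage.
have BS : {ae mu, forall x : borel T, B (S x) <-> B x}.
  apply: filterS GS => x Gx; split=> -[j /= jM].
    rewrite /preimage /= -iterSr => H.
    (* The index leaves the range only when j + 1 = M, and then the invariance of D and G under S^M
       brings it back to 0. *)
    have [jM'|] := ltnP j.+1 M; first by exists j.+1.
    move=> Mj; have jE : j.+1 = M by apply/eqP; rewrite eqn_leq jM.
    by exists 0%N => //; move: H; rewrite jE => -[/DS ? /Gx ?].
  case: j jM => [|j] jM H.
    exists M.-1; rewrite /= ?prednK// /preimage /= -iterSr prednK//.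
    by case: H => /= ? ?; split; [exact/DS|exact/Gx].
  by exists j; rewrite /= ?(ltnW jM)// /preimage /= -iterSr.
have [B0|B1] := unique_ergodic mB BS; [left|right].
  by apply: (subset_measure0 mDG mB _ B0) => x xDG; exists 0%N.
have mBC : measurable (~` B) by exact: measurableC.
apply: (subset_measure0 (measurableD mD mG) mBC); last first.
  by rewrite [LHS](probability_setC mu mB) B1 subee.
move=> x [Dx nGx] [j /= jM [Dj Gj]]; apply: nGx.
have := DM x j Dx Dj; case: j jM Dj Gj => // j jM _ _.
by move=> /dvdn_leq => /(_ isT); rewrite leqNgt jM.
Qed.

End Ergodic.

Section L2.
Variables (R : realType) (T : ptopologicalType).
Variable mu : probability (borel T) R.

Lemma L2norm_square (v : T -> R[i]) :
  (L2norm mu v `^ 2 = \int[mu]_x (complex.Re (v x) ^+ 2 + complex.Im (v x) ^+ 2)%:E)%E.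
Proof.
rewrite /L2norm poweR_Lnorm//; apply: eq_integral => x _.
rewrite /= powR_mulrn// ger0_norm ?normc_ge0//.
by case: (v x) => a b /=; rewrite sqr_sqrtr// addr_ge0 ?sqr_ge0.
Qed.

(** Markov's inequality for |v|^2: on A one has 1 <= 4 |v|^2. *)
Lemma chebyshev_L2 (v : T -> R[i]) (A : set (borel T)) (e : R) :
  measurable_fun [set: borel T] (fun x => complex.Re (v x)) ->
  measurable_fun [set: borel T] (fun x => complex.Im (v x)) ->
  measurable A -> (L2norm mu v < e%:E)%E ->
  (forall x, A x -> 1 / 2 <= normc (v x)) -> (mu A <= (4 * e ^+ 2)%:E)%E.
Proof.
move=> mRe mIm mA ve Av.
have nv0 : (0 <= L2norm mu v)%E by exact: Lnorm_ge0.
have e0 : 0 < e by rewrite -lte_fin (le_lt_trans nv0).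
have : (L2norm mu v `^ 2 <= e%:E `^ 2)%E.
  apply: gt0_ler_poweR => //; last exact: ltW.
  - by rewrite in_itv /= nv0 leey.
  - by rewrite in_itv /= lee_fin (ltW e0) leey.
rewrite L2norm_square poweR_EFin powR_mulrn ?(ltW e0)// => int_le.
have : (\int[mu]_x (\1_A x)%:E <=
    \int[mu]_x (4 * (complex.Re (v x) ^+ 2 + complex.Im (v x) ^+ 2))%:E)%E.
  apply: ge0_le_integral => //.
  - by apply/measurable_EFinP; exact: measurable_indic.
  - apply/measurable_EFinP; apply: measurable_funM => //.
    by apply: measurable_funD; exact: measurable_funX.
  - move=> x _; rewrite lee_fin indicE.
    have [xA|_] := boolP (x \in A); last by rewrite mulr_ge0// addr_ge0 ?sqr_ge0.
    have := Av x (set_mem xA); case: (v x) => a b /= h.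
    have ab0 : 0 <= a ^+ 2 + b ^+ 2 by rewrite addr_ge0 ?sqr_ge0.
    rewrite -(sqr_sqrtr ab0); set s := Num.sqrt _ in h *.
    by rewrite /= -[X in X <= _]/1; nra.
rewrite integral_indic// setIT => /le_trans; apply.
under eq_integral do rewrite EFinM.
rewrite ge0_integralZl//.
- by rewrite EFinM lee_wpmul2l.
- apply/measurable_EFinP; by apply: measurable_funD; exact: measurable_funX.
- by move=> x _; rewrite lee_fin addr_ge0 ?sqr_ge0.
Qed.

Lemma indic_L2 (A : set (borel T)) : measurable A ->
  L2 mu (fun x => (\1_A x : R)%:C%C).
Proof.
move=> mA; split => /=.
- exact: measurable_indic.
- exact: measurable_cst.
apply: (@lty_poweRy _ _ 2) => //; rewrite L2norm_square /=.
apply: (@le_lt_trans _ _ (\int[mu]_x (\1_A x)%:E)%E); last first.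
  by rewrite integral_indic// setIT (le_lt_trans (probability_le1 mu mA))// ltry.
rewrite le_eqVlt; apply/orP; left; apply/eqP; apply: eq_integral => x _.
by rewrite indicE; case: (_ \in _); rewrite ?expr1n ?expr0n addr0.
Qed.

End L2.

Section EigenSpan.
Variables (R : realType) (T : ptopologicalType) (S : T -> T).
Variable mu : probability (borel T) R.
Hypothesis mS : measurable_fun [set: borel T] (S : borel T -> borel T).
Hypothesis inv : invariant_measure S mu.

Lemma ae_preimage (P : T -> Prop) :
  {ae mu, forall x : borel T, P x} -> {ae mu, forall x : borel T, P (S x)}.
Proof.
move=> [N [mN N0 PN]]; exists (S @^-1` N); split.
- exact: measurable_preimage.
- by rewrite -[LHS]/(mu (S @^-1` N)) inv.
- by move=> x /= nP; exact: PN.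
Qed.

Lemma eigenfunction_iter (f : T -> R[i]) lam k : is_eigenfunction S mu f lam ->
  {ae mu, forall x : borel T, f (iter k S x) = lam ^+ k * f x}.
Proof.
move=> [_ _ _ fS]; elim: k => [|k IH].
  by exists set0; split => // x; rewrite /= mul1r.
apply: filterS2 (ae_preimage IH) fS => x /= IHx fSx.
by rewrite -iterS iterSr IHx fSx mulrA -exprSr.
Qed.

Lemma eigen_span_measurable (g : T -> R[i]) : eigen_span S mu g ->
  measurable_fun [set: borel T] (fun x => complex.Re (g x)) /\
  measurable_fun [set: borel T] (fun x => complex.Im (g x)).
Proof.
move=> [N [c [lam [f [ef gE]]]]].
have mf i : measurable_fun [set: borel T] (fun x => complex.Re (f i x)) /\
    measurable_fun [set: borel T] (fun x => complex.Im (f i x)).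
  by case: (ef i) => -[].
split.
  rewrite (_ : (fun x => _) = fun x => \sum_(i < N)
      (complex.Re (c i) * complex.Re (f i x) - complex.Im (c i) * complex.Im (f i x))).
    apply: measurable_sum => i; apply: measurable_funB; apply: measurable_funM => //;
    by case: (mf i).
  apply/funext => x; rewrite gE raddf_sum; apply: eq_bigr => i _.
  by case: (c i) => a b; case: (f i x).
rewrite (_ : (fun x => _) = fun x => \sum_(i < N)
    (complex.Re (c i) * complex.Im (f i x) + complex.Im (c i) * complex.Re (f i x))).
  apply: measurable_sum => i; apply: measurable_funD; apply: measurable_funM => //;
  by case: (mf i).
apply/funext => x; rewrite gE raddf_sum; apply: eq_bigr => i _.
by case: (c i) => a b; case: (f i x).
Qed.

(** Only finitely many eigenvalues occur, and along the divisibility chain P the largest exponent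
    works for all of them. *)
Lemma eigen_span_periodic (P : nat -> nat) (g : T -> R[i]) :
  (forall m n, (m <= n)%N -> (P m %| P n)%N) ->
  (forall lam, is_eigenvalue S mu lam -> exists n, lam ^+ P n = 1) ->
  eigen_span S mu g ->
  exists n, {ae mu, forall x : borel T, g (iter (P n) S x) = g x}.
Proof.
move=> Pdvd root [N [c [lam [f [ef gE]]]]].
have /choice[n lamn] i : exists n, lam i ^+ P n = 1 by apply: root; exists (f i).
exists (\max_(i < N) n i)%N; set m := (\max_(i < N) n i)%N.
have : {ae mu, forall x : borel T, forall i : 'I_N, f i (iter (P m) S x) = f i x}.
  apply: filter_forall => i; apply: filterS (eigenfunction_iter (P m) (ef i)) => x ->.
  have /dvdnP[k ->] := Pdvd _ _ (leq_bigmax i : n i <= m)%N.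
  by rewrite mulnC exprM lamn expr1n mul1r.
by apply: filterS => x fx; rewrite !gE; apply: eq_bigr => i _; rewrite fx.
Qed.

End EigenSpan.

(** * Phases in the odometer and the letter at 0 *)

Section Phase.
Variables (th : directive) (q : nat -> nat) (h : nat).
Hypotheses (thq : constant_length th q) (h0 : (0 < h)%N).
Hypothesis hq : forall n, coprime h (q n).
Local Notation X := (subshift th 0).
Local Notation S := (@shift_map th 0).
Variable pi : fullshift th 0 -> odometer_space q h.
Hypothesis cpi : {within X, continuous pi}.
Hypothesis piS : forall x, X x -> pi (S x) = rotation (pi x).

(** As p_n and h are coprime, this pair amounts to a residue modulo p_n h. *)
Definition phase n (x : fullshift th 0) : Zmod (pp q n) * Zmod h :=
  ((pi x).1 n, (pi x).2).

Lemma phase_near n x : X x ->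
  nbhs x [set y | X y -> phase n y = phase n x].
Proof.
move=> Xx.
pose A : set (odometer_space q h) :=
  [set z | z.1 n = (pi x).1 n /\ z.2 = (pi x).2].
have nA : nbhs (pi x) A.
  exists ([set g | g n = (pi x).1 n], [set (pi x).2]); last by move=> [a b] [].
  split=> //=.
  exact: (@proj_continuous _ (fun n => discrete_topology (Zmod (pp q n))) n (pi x).1
    [set (pi x).1 n]).
have nW : nbhs x [set y | X y -> A (pi y)].
  exact: (@subspace_continuousP _ _ _ pi).1 cpi x Xx A nA.
by apply: filterS nW => y /= yA /yA[p1 p2]; rewrite /phase p1 p2.
Qed.

(** The letter at 0 and the phase are locally constant on the closed set X. Since B is arbitrary,
    applying this to B and to its negation shows that such sets are relatively clopen. *)
Lemma phase_closed n (B : alph th 0 -> Zmod (pp q n) * Zmod h -> Prop) :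
  closed [set x | X x /\ B (x 0) (phase n x)].
Proof.
move=> x cx.
have Xx : X x by apply: subshift_closed; apply: closureS cx => y [].
split=> //.
have n0 : nbhs x [set y : fullshift th 0 | y 0 = x 0].
  by apply: open_nbhs_nbhs; split=> //; exact: (coord_clopen 0 [set x 0]).1.
have [y [[Xy By] [/= y0 yph]]] := cx _ (filterI n0 (phase_near n Xx)).
by rewrite -y0 -yph.
Qed.

Lemma pi_iter x j : X x -> pi (iter j S x) = iter j (@rotation q h) (pi x).
Proof.
by move=> Xx; elim: j => //= j <-; apply: piS; exact: subshift_iter.
Qed.

Lemma coprime_pp n : coprime (pp q n) h.
Proof.
elim: n => [|n IH]; first by rewrite pp0 coprime1n.
by rewrite ppS coprimeMl IH coprime_sym hq.
Qed.

Lemma phase_iter n x j : X x ->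
  phase n (iter j S x) = phase n x <-> (pp q n * h %| j)%N.
Proof.
move=> Xx; rewrite /phase pi_iter//; split=> [[E1 E2]|nj]; last first.
  by have [-> ->] := rotation_period thq h0 (pi x) (leqnn n) nj.
have [R1 R2] := rotation_iter thq h0 (pi x) j.
have dvd_mod m a : (a = a + j %[mod m])%N -> (m %| j)%N.
  by move/eqP; rewrite -[X in X == _ %[mod _]]addn0 eqn_modDl mod0n eq_sym.
rewrite Gauss_dvd ?coprime_pp//; apply/andP; split.
  by apply: (@dvd_mod _ ((pi x).1 n : Zmod (pp q n))); rewrite -(R1 n) E1.
by apply: (@dvd_mod _ ((pi x).2 : Zmod h)); rewrite -R2 E2.
Qed.

End Phase.

Section LetterPhase.
Variables (R : realType) (th : directive) (q : nat -> nat) (h : nat).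
Hypotheses (thq : constant_length th q) (h0 : (0 < h)%N).
Hypothesis hq : forall n, coprime h (q n).
Local Notation T := (fullshift th 0).
Local Notation X := (subshift th 0).
Local Notation S := (@shift_map th 0).
Variable pi : fullshift th 0 -> odometer_space q h.
Hypothesis cpi : {within X, continuous pi}.
Hypothesis piS : forall x, X x -> pi (S x) = rotation (pi x).
Variable mu : probability (borel T) R.
Hypothesis ue : unique_invariant_measure S mu X.
Hypothesis ds : discrete_spectrum S mu.
Hypothesis root : forall lam, is_eigenvalue S mu lam -> exists n, lam ^+ (pp q n * h) = 1.

Lemma closed_borel (A : set T) : closed A -> measurable (A : set (borel T)).
Proof.
move=> cA; rewrite -[A]setCK; apply: measurableC; apply: sub_sigma_algebra.
exact: closed_openC.
Qed.

Lemma shift_map_measurable : measurable_fun [set: borel T] (S : borel T -> borel T).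
Proof.
apply: (@measurability _ _ (borel T) (borel T) _ _ (@open T : set (set (borel T)))) => //.
move=> _ [B oB <-]; rewrite setTI; apply: sub_sigma_algebra.
by apply: open_comp => // x _; exact: shift_map_continuous.
Qed.

(* Off [C], whether the letter at 0 is [a] is determined by the phase: by
   [phase_dichotomy] a superlevel set of a combination of eigenfunctions that
   approximates the indicator function of [a] is a union of phases. *)
Lemma letter_phase (a : alph th 0) (e : R) : 0 < e ->
  exists n, exists C : set T, [/\ clopen C, (mu C < e%:E)%E
  & forall x y, X x -> X y -> phase pi n x = phase pi n y -> ~ C x -> ~ C y ->
      (x 0 = a <-> y 0 = a)].
Proof.
move=> e0; have [inv X1 _] := ue.
have mX : measurable (X : set (borel T)) by apply: closed_borel; exact: subshift_closed.
pose A : set (borel T) := [set x | x 0 = a].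
have mA : measurable A by apply: closed_borel; exact: (coord_clopen 0 [set a]).2.
pose F (x : T) : R[i] := (\1_A x : R)%:C%C.
have FL2 : L2 mu F by exact: indic_L2.
(* With this d the bound of [chebyshev_L2] is 4 d^2 = e / 4. *)
pose d := Num.sqrt e / 4.
have d0 : 0 < d by rewrite divr_gt0// sqrtr_gt0.
have d4 : 4 * d ^+ 2 < e.
  by rewrite /d exprMn sqr_sqrtr ?ltW//; lra.
have [_ /(_ d d0)[g gspan Fg]] : eigen_closed_span S mu F by rewrite ds.
have [mRe mIm] := eigen_span_measurable gspan.
have Pdvd m n : (m <= n)%N -> (pp q m * h %| pp q n * h)%N.
  by move=> mn; rewrite dvdn_mul// dvdn_pp.
have [n gn] := eigen_span_periodic shift_map_measurable inv Pdvd root gspan.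
pose G : set (borel T) := [set x | 1 / 2 < complex.Re (g x)].
have mG : measurable G.
  have := mRe measurableT `]1 / 2, +oo[%classic (measurable_itv _).
  rewrite setTI; congr measurable; apply/funext => x.
  by rewrite /preimage /= in_itv /= andbT.
pose D z : set (borel T) := [set x | X x /\ phase pi n x = z].
have mD z : measurable (D z).
  by apply: closed_borel; exact: (@phase_closed th q h pi cpi n (fun _ w => w = z)).
(* W z says that G fills the phase z up to a null set; by [dich] G is otherwise null on it, so
   almost everywhere G is the union of the phases in W. *)
pose W z := mu (D z `\` G) = 0%E.
have dich z : ~ W z -> mu (D z `&` G) = 0%E.
  have M0 : (0 < pp q n * h)%N by rewrite muln_gt0 (pp_gt0 thq).
  have DM x j : D z x -> D z (iter j S x) -> (pp q n * h %| j)%N.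
    move=> [Xx xz] [_ xjz]; apply/(phase_iter thq h0 hq piS n j Xx).
    by rewrite xjz.
  have DS x : D z (iter (pp q n * h) S x) <-> D z x.
    split=> -[Xx xz].
      have Xx' : X x by elim: (_ * _)%N Xx {xz} => // k IH /= /subshift_shift.
      split=> //; rewrite -xz; apply/esym/(phase_iter thq h0 hq piS n _ Xx').
      exact: dvdnn.
    split; first exact: subshift_iter.
    by rewrite -xz; apply/(phase_iter thq h0 hq piS n _ Xx); exact: dvdnn.
  have GS : {ae mu, forall x : borel T, G (iter (pp q n * h) S x) <-> G x}.
    by apply: filterS gn => x; rewrite /G /= => ->.
  by case: (phase_dichotomy mX shift_map_measurable ue M0 (mD z) mG DM DS GS).
pose Bad : set T := [set x | X x /\ ~ (x 0 = a <-> W (phase pi n x))].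
have cBad : closed Bad by exact: (@phase_closed th q h pi cpi n (fun b z => ~ (b = a <-> W z))).
have cXBad : closed (X `\` Bad).
  rewrite (_ : _ `\` _ = [set x | X x /\ (x 0 = a <-> W (phase pi n x))]).
    exact: (@phase_closed th q h pi cpi n (fun b z => b = a <-> W z)).
  rewrite eqEsubset; split => x /= [Xx Bx]; split=> //.
    by apply: contrapT => nB; exact: Bx.
  by case.
have BadX : Bad `<=` X by move=> x [].
have [C cC CX] := clopen_trace (@fullshift_hausdorff th 0)
  (@fullshift_zero_dimensional th 0) (@fullshift_compact th 0) cBad cXBad BadX.
exists n, C; split=> //; last first.
  move=> x y Xx Xy xy nCx nCy.
  have good w : X w -> ~ C w -> (w 0 = a <-> W (phase pi n w)).
    move=> Xw nCw; apply: contrapT => nw; apply: nCw.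
    by have : Bad w by []; rewrite -CX => -[].
  by rewrite (good x)// (good y)// xy.
(* On this symmetric difference the indicator of A and the real part of g differ by at least 1/2; up
   to a null set it contains C. *)
pose E : set (borel T) := (G `\` A) `|` (A `\` G).
have mE : measurable E by apply: measurableU; apply: measurableD.
have muE : (mu E <= (4 * d ^+ 2)%:E)%E.
  apply: (chebyshev_L2 _ _ mE Fg).
  - rewrite (_ : (fun x => _) = fun x => \1_A x - complex.Re (g x)).
      by apply: measurable_funB => //; exact: measurable_indic.
    by apply/funext => x; rewrite raddfB.
  - rewrite (_ : (fun x => _) = fun x => 0 - complex.Im (g x)).
      by apply: measurable_funB => //; exact: measurable_cst.
    by apply/funext => x; rewrite raddfB.
  - move=> x Ex; have [re _ _] := normc_ReIm (F x - g x).
    apply: le_trans re; rewrite raddfB /= indicE.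
    case: Ex => -[].
      move=> Gx nAx; rewrite memNset// sub0r normrN; apply: le_trans (ler_norm _).
      exact: ltW.
    move=> Ax /negP nG; rewrite mem_set//; apply: le_trans (ler_norm _).
    by rewrite -[X in X - _]/1; move: nG; rewrite -leNgt /=; lra.
have CE : {ae mu, forall x : borel T, C x -> E x}.
  have null z : {ae mu, forall x : borel T, D z x -> (W z <-> G x)}.
    have [Wz|nWz] := pselect (W z).
      exists (D z `\` G); split; [by apply: measurableD|exact: Wz|].
      move=> x /= nx; apply: contrapT => nDG; apply: nx => Dx.
      by split=> // _; apply: contrapT => nGx; apply: nDG.
    exists (D z `&` G); split; [by apply: measurableI|exact: dich|].
    move=> x /= nx; apply: contrapT => nDG; apply: nx => Dx.
    by split=> // Gx; exfalso; apply: nDG.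
  have aeX : {ae mu, forall x : borel T, X x}.
    exists (~` X); split=> //; first exact: measurableC.
    by rewrite [LHS](probability_setC mu mX) X1 subee.
  have : {ae mu, forall x : borel T, forall z : Zmod (pp q n) * Zmod h, D z x -> (W z <-> G x)}.
    exact: filter_forall.
  move=> aeWG; have FF := ae_filter_ringOfSetsType mu.
  apply: (@filterS2 _ _ FF _ _ _ _ aeX aeWG) => x Xx WG Cx.
  have [_ xa] : Bad x by rewrite -CX.
  have {}WG := WG (phase pi n x) (conj Xx erefl).
  have [Ax|nAx] := pselect (x 0 = a).
    by right; split=> // /WG Wx; apply: xa.
  left; split=> //; apply/WG; apply: contrapT => nW; apply: xa.
  by split.
have mC : measurable (C : set (borel T)) by apply: closed_borel; case: cC.
apply: le_lt_trans (ae_measure_le mC mE CE) _.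
by apply: le_lt_trans muE _; rewrite lte_fin.
Qed.

End LetterPhase.

(** * Hamming distance of windows with equal phases *)

Section WordsClose.
Variables (R : realType) (th : directive) (q : nat -> nat) (h : nat).
Hypotheses (thq : constant_length th q) (h0 : (0 < h)%N).
Hypothesis hq : forall n, coprime h (q n).
Local Notation T := (fullshift th 0).
Local Notation X := (subshift th 0).
Local Notation S := (@shift_map th 0).
Variable pi : fullshift th 0 -> odometer_space q h.
Hypothesis cpi : {within X, continuous pi}.
Hypothesis piS : forall x, X x -> pi (S x) = rotation (pi x).
Variable mu : probability (borel T) R.
Hypothesis ue : unique_invariant_measure S mu X.
Hypothesis ds : discrete_spectrum S mu.
Hypothesis root : forall lam, is_eigenvalue S mu lam -> exists n, lam ^+ (pp q n * h) = 1.

(** At a disagreement, let a be the letter in the first window: the phases agree, so one of the two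
    orbit points lies in the exceptional set C a. Uniform visit bounds for these finitely many sets
    control the Hamming distance. *)
Lemma words_close (u : T) (D : nat) : X u ->
  exists n0 L0, forall L, (L0 <= L)%N -> forall s t : nat,
    s = t %[mod pp q n0 * h] -> (D * hamming (word u s L) (word u t L) <= L)%N.
Proof.
move=> Xu.
pose K := #|alph th 0|.
have K0 : (0 < K)%N by exact: alph_gt0.
(* Two windows and K letters give at most 2 K e L = L / (D + 1) disagreements; D + 1 avoids dividing
   by 0. *)
pose e : R := (2 * K * D.+1)%:R^-1.
have e0 : 0 < e by rewrite invr_gt0 ltr0n !muln_gt0 K0.
have /choice[n /choice[C CP]] a := letter_phase thq h0 hq cpi piS ue ds root a e0.
have clopenS A : clopen A -> clopen (S @^-1` A).
  by move=> cA; apply: preimage_clopen => //; exact: shift_map_continuous.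
have Xi i : X (iter i S u) by exact: subshift_iter.
have /choice[L0 L0P] a : exists L0, forall L, (L0 <= L)%N -> forall s,
    hits R S u (C a) s L <= e * L%:R.
  have [cC mC _] := CP a.
  exact: (uniform_visits (@fullshift_hausdorff th 0) (@fullshift_zero_dimensional th 0)
    (@fullshift_compact th 0) (@fullshift_countable_clopen R th 0) clopenS
    (@subshift_closed th 0) Xi ue cC mC).
(* Since the p_n divide one another, congruence modulo the largest one gives equal phases at every
   level n a. *)
exists (\max_a n a)%N, (\max_a L0 a)%N => L L0L s t st.
have samephase a j : phase pi (n a) (iter (s + j) S u) = phase pi (n a) (iter (t + j) S u).
  wlog le_st : s t st / (s <= t)%N.
    move=> H; have [/H->//|/ltnW ts] := leqP s t; apply/esym/H => //.
  have -> : (t + j = (t - s) + (s + j))%N by lia.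
  rewrite (iterD (t - s)); apply/esym/(phase_iter thq h0 hq piS _ _ (Xi _)).
  apply: (@dvdn_trans (pp q (\max_a n a) * h)).
    by rewrite dvdn_mul// dvdn_pp// leq_bigmax.
  by rewrite -eqn_mod_dvd//; apply/eqP.
have x0 := enum_val (Ordinal (alph_gt0 th 0)).
have ham : (hamming (word u s L) (word u t L))%:R <=
    \sum_a (hits R S u (C a) s L + hits R S u (C a) t L).
  rewrite (hamming_sum x0) ?size_mkseq// natr_sum.
  under [leRHS]eq_bigr do rewrite /hits -big_split /=.
  rewrite exchange_big /=; apply: ler_sum => j _.
  rewrite !nth_mkseq//.
  have sum0 (P : pred (alph th 0)) : 0 <= \sum_(a | P a)
      (\1_(C a) (iter (s + j) S u) + \1_(C a) (iter (t + j) S u)) :> R.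
    by apply: sumr_ge0 => a _; rewrite addr_ge0// indicE.
  case: eqP => /= neq; first exact: (sum0 xpredT).
  rewrite (bigD1 (u (s%:Z + j%:Z)))//= -[leLHS]addr0 lerD//.
  set a := u _ in neq *.
  have [_ _ /(_ _ _ (Xi (s + j)%N) (Xi (t + j)%N) (samephase a j))] := CP a.
  rewrite !iter_shift_map !add0r !PoszD -/a => H.
  rewrite !indicE.
  have [//|nCx] := boolP (_ \in C a); first by rewrite lerDl.
  have [|nCy] := boolP (_ \in C a); first by rewrite add0r.
  exfalso; apply: neq; apply/esym/(H _ _).1 => //.
  - by move=> Cx; move: nCx; rewrite mem_set.
  - by move=> Cy; move: nCy; rewrite mem_set.
have bound : (hamming (word u s L) (word u t L))%:R <= K%:R * (2 * e * L%:R) :> R.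
  apply: le_trans ham _.
  rewrite mulr_natl -sumr_const; apply: ler_sum => a _.
  have La : (L0 a <= L)%N by apply: leq_trans L0L; exact: leq_bigmax.
  have := L0P a L La s; have := L0P a L La t; lra.
rewrite -(ler_nat R) natrM.
apply: (@le_trans _ _ (D.+1%:R * (hamming (word u s L) (word u t L))%:R)).
  by rewrite ler_wpM2r// ler_nat.
apply: (@le_trans _ _ (D.+1%:R * (K%:R * (2 * e * L%:R)))).
  by rewrite ler_wpM2l.
rewrite (_ : _ * _ = L%:R)// /e !natrM; field.
by rewrite nat1r !pnatr_eq0 /= -lt0n K0.
Qed.

End WordsClose.

(** * From close windows to the column number *)

Lemma pp_unbounded (th : directive) (q : nat -> nat) : constant_length th q ->
  (forall N, exists2 n, (N <= n)%N & (1 < q n)%N) ->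
  forall N, exists n, (N <= pp q n)%N.
Proof.
move=> thq q1; elim=> [|N [n Nn]]; first by exists 0%N.
have [m nm qm] := q1 n; exists m.+1; rewrite ppS.
have : (pp q n <= pp q m)%N by rewrite dvdn_leq ?(pp_gt0 thq)// dvdn_pp.
have := pp_gt0 thq m; nia.
Qed.

Theorem proposition55 (R : realType) (th : directive) (q : nat -> nat)
    (mu : probability (borel (fullshift th 0)) R) (c : nat)
    (htf : torsion_free th q) (hsize : bounded_size th)
    (hue : unique_invariant_measure (@shift_map th 0) mu (subshift th 0))
    (hc : is_column_number th q c) (hc1 : (1 < c)%N) :
  mixed_spectrum (@shift_map th 0) mu \/
  (discrete_spectrum (@shift_map th 0) mu /\
   exists lam : R[i], is_eigenvalue (@shift_map th 0) mu lam /\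
     ~ has_continuous_eigenfunction (subshift th 0) (@shift_map th 0) lam).
Proof.
have [thq q1 _ _ _] := htf.
have [h [u [bth [hh ufib [tau [tau_inj tau_range tau_morph]] cE]]]] := hc.
have [h0 hq [_ [pi [cpi piX piS] _]]] := hh.
have [ds|] := pselect (discrete_spectrum (@shift_map th 0) mu); last by left.
right; split=> //; apply: contrapT => nodisc.
have root lam : is_eigenvalue (@shift_map th 0) mu lam -> exists n, lam ^+ (pp q n * h) = 1.
  move=> lamE; apply: (eigenvalue_root thq h0 hh); first by case: lamE => f [].
  by apply: contrapT => nc; apply: nodisc; exists lam.
have close : close_letters bth q.
  apply: (pure_base_close thq h0 (fun n => (ufib n).2) tau_inj tau_range tau_morph).
    exact: pp_unbounded thq q1.
  by move=> D; apply: (words_close thq h0 hq cpi piS hue ds root); exact: (ufib 0%N).1.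
have bthq : constant_length bth q by exact: pure_base_constant_length tau_range tau_morph.
have bK : bounded_size bth by exact: pure_base_bounded_size tau_inj tau_range hsize.
by move: hc1; rewrite cE ltnNge naive_column_number_le1.
Qed.
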